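(* Let $w$ be an admissible weight on $\{0\le s\le t\le b\}$, let $k\in L^1(0,b)$ satisfy the weighted Sonine condition WSC1 with respect to $w$, and let $K\in L^1(0,b)$ be the associated kernel. Suppose $f\in W^{1,1}(0,b)$. Then the first-kind Volterra integral equation $$\int_0^t K(t-s)u(s)\,ds=f(t),\qquad t\in(0,b),$$ admits a unique solution $u\in L^1(0,b)$. In particular (taking $f= 1$), $K$ satisfies the classical Sonine condition, with associated kernel the corresponding solution $u$, i.e. there is $u\in L^1(0,b)$ with $\int_0^tK(t-s)u(s)\,ds=1$.
   Context: Fix $b>0$. All functions are real-valued. For a function $q$ of two variables, $q_2$ denotes its partial derivative in the second variable. Equations in $t$ between integrable functions are understood for almost every $t$. Admissible weight: a measurable $w$ on $\{0\le s\le t\le b\}$ such that for each $s$ the map $t\mapsto w(s,t)$ is absolutely continuous on $[s,b]$ (so $w(s,t)=w(s,s)+\int_s^tw_2(s,\theta)\,d\theta$), and (i) there are $0<\mu_*\le\mu^*$ with $\mu_*\le|w(t,t)|\le\mu^*$ for $t\in[0,b]$; (ii) there is $\bar w\in L^1(0,b)$ with $|w_2(s,t)|\le\bar w(t-s)$ for $0\le s\le t\le b$ (a.e. $t$). WSC1: $k\in L^1(0,b)$ satisfies WSC1 with respect to $w$, with associated kernel $K\in L^1(0,b)$ and function $g$, if $$\int_0^t w(s,z+s)K(t-z)k(z)\,dz=g(s,t),\qquad s,t\ge0,\ 0\le s+t\le b,$$ (for each $s$, for a.e. $t\in(0,b-s)$), where $g$ is a measurable function on $\{s,t\ge 0,\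 s+t\le b\}$, absolutely continuous in $t\in[0,b-s]$ for each $s$ (so $g(s,0)$ is the limit as $t\to0^+$), such that (a) there are $0<\nu_*\le\nu^*$ with $\nu_*\le|g(s,0)|\le\nu^*$ for $0\le s\le b$; (b) there is $\bar g\in L^1(0,b)$ with $|g_2(s,t)|\le\bar g(t)$ for $0\le s+t\le b$ (a.e. $t$). Classical Sonine condition (CSC): a kernel $\kappa\in L^1(0,b)$ satisfies the CSC with associated kernel $\tilde\kappa\in L^1(0,b)$ if $\int_0^t\tilde\kappa(t-s)\kappa(s)\,ds=1$ for a.e. $t\in(0,b)$. *)

(* Defs.v *)
From HB Require Import structures.
From mathcomp Require Import all_boot all_order all_algebra.
From mathcomp Require Import all_classical all_reals all_analysis.
Set Implicit Arguments.
Unset Strict Implicit.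
Unset Printing Implicit Defensive.
Import Order.TTheory GRing.Theory Num.Theory.
Import numFieldNormedType.Exports.
Local Open Scope classical_set_scope.
Local Open Scope ring_scope.

(* Functions on an interval, triangle, etc. are represented by total functions;
   no definition below depends on their values outside the relevant set.
   Elements of L^1 and W^{1,1} are represented by Borel functions, and equality
   in these spaces is equality almost everywhere. *)

Section Definitions.
Context {R : realType}.
Local Notation mu := (@lebesgue_measure R).
Implicit Types (b : R) (f g u k K : R -> R) (w : R -> R -> R).

Definition L1 b f : Prop := mu.-integrable `]0, b[ (EFin \o f).

(* When t |-> f (t - s) * g s is not integrable the value is a dummy one; for
   f, g in L^1(0, b) this occurs only for t in a null set. *)
Definition conv f g (t : R) : R := \int[mu]_(s in `]0, t[) (f (t - s) * g s).

(* Lebesgue measurability on a Borel subset D of the plane. [measurable_fun] is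
   Borel measurability, and a function is Lebesgue measurable if and only if it
   is almost everywhere equal to a Borel measurable one. *)
Definition lebesgue_measurable2 (D : set (R * R)) w : Prop :=
  exists2 w' : R * R -> R, measurable_fun D w' &
    {ae (mu \x mu)%E, forall p, D p -> w p.1 p.2 = w' p}.

(* The classical epsilon-delta definition on [a, c]; (I i).1 and (I i).2 are the
   endpoints of finitely many non-overlapping subintervals. *)
Definition absolutely_continuous_on (a c : R) f : Prop :=
  forall e : R, 0 < e -> exists2 d : R, 0 < d &
    forall (n : nat) (I : 'I_n -> R * R),
      (forall i, [/\ a <= (I i).1, (I i).1 <= (I i).2 & (I i).2 <= c]) ->
      trivIset setT (fun i => `](I i).1, (I i).2[%classic) ->
      \sum_(i < n) ((I i).2 - (I i).1) < d ->
      \sum_(i < n) `|f (I i).2 - f (I i).1| < e.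

Definition test_function b (phi : R -> R) : Prop :=
  [/\ forall (n : nat) (x : R), derivable (derive1n n phi) x 1,
      compact (closure [set x | phi x != 0]) &
      closure [set x | phi x != 0] `<=` `]0, b[ ].

Definition weak_derivative b f g : Prop :=
  forall phi : R -> R, test_function b phi ->
    \int[mu]_(x in `]0, b[) (f x * derive1 phi x) =
    - \int[mu]_(x in `]0, b[) (g x * phi x).

Definition W11 b f : Prop :=
  L1 b f /\ exists2 g : R -> R, L1 b g & weak_derivative b f g.

(* Here w_2(s, t) is [derive1 (w s) t]; since w s is absolutely continuous, the
   derivative exists for almost every t. *)
Record admissible_weight b w : Prop := AdmissibleWeight {
  weight_measurable : lebesgue_measurable2
    [set p | [/\ 0 <= p.1, p.1 <= p.2 & p.2 <= b]] w ;
  weight_ac : forall s, 0 <= s <= b -> absolutely_continuous_on s b (w s) ;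
  weight_diag : exists m M : R, [/\ 0 < m, m <= M &
    forall t, 0 <= t <= b -> m <= `|w t t| <= M] ;
  weight_deriv : exists2 wbar : R -> R, L1 b wbar &
    forall s, 0 <= s <= b ->
      {ae mu, forall t, s < t < b -> `|derive1 (w s) t| <= wbar (t - s)} }.

(* k satisfies the weighted Sonine condition with respect to w, with associated
   kernel K and function g. *)
Record WSC1 b w k K (g : R -> R -> R) : Prop := IsWSC1 {
  WSC1_k : L1 b k ;
  WSC1_K : L1 b K ;
  WSC1_eq : forall s, 0 <= s <= b ->
    {ae mu, forall t, 0 < t < b - s ->
      \int[mu]_(z in `]0, t[) (w s (z + s) * K (t - z) * k z) = g s t} ;
  WSC1_measurable : lebesgue_measurable2
    [set p | [/\ 0 <= p.1, 0 <= p.2 & p.1 + p.2 <= b]] g ;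
  WSC1_ac : forall s, 0 <= s <= b -> absolutely_continuous_on 0 (b - s) (g s) ;
  WSC1_0 : exists m M : R, [/\ 0 < m, m <= M &
    forall s, 0 <= s <= b -> m <= `|g s 0| <= M] ;
  WSC1_deriv : exists2 gbar : R -> R, L1 b gbar &
    forall s, 0 <= s <= b ->
      {ae mu, forall t, 0 < t < b - s -> `|derive1 (g s) t| <= gbar t} }.

(* kappa satisfies the classical Sonine condition, with associated kernel
   kappat. *)
Definition CSC b (kappa kappat : R -> R) : Prop :=
  [/\ L1 b kappa, L1 b kappat &
      {ae mu, forall t, 0 < t < b -> conv kappat kappa t = 1}].

Definition volterra_solution b K f u : Prop :=
  L1 b u /\ {ae mu, forall t, 0 < t < b -> conv K u t = f t}.

End Definitions.

(* Main.v *)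
(* It suffices to find kappa in L^1(0, b) with K * kappa = 1. Indeed, if
   f = C + int_0^t f', then u = C kappa + kappa * f' solves K * u = f, and
   K * v = 0 gives 1 * v = kappa * (K * v) = 0, whence v = 0.

   One looks for kappa in the form
     kappa(t) = c w(0, t) k(t) + int_0^t w(s, t) k(t - s) phi(s) ds,
   with c = 1 / g(0, 0). By the weighted Sonine condition at each s,
     (K * kappa)(t) = c g(0, t) + int_0^t g(s, t - s) phi(s) ds
   and, as g(s, t - s) = g(s, 0) + int_0^{t - s} g_2(s, x) dx, this is 1 as soon
   as phi solves the second-kind equation
     g(s, 0) phi(s) + int_0^s g_2(r, s - r) phi(r) dr = - c g_2(0, s),
   whose kernel is dominated by the convolution kernel gbar. Such an equation is
   solvable because a weight exp (- n t) makes its kernel contracting. *)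
Require Import Defs.
From HB Require Import structures.
From mathcomp Require Import all_boot all_order all_algebra.
From mathcomp Require Import all_classical all_reals all_analysis.
From mathcomp Require Import measurable_realfun.
From mathcomp Require Import ring lra.
Import Order.TTheory GRing.Theory Num.Theory.
Import numFieldNormedType.Exports.
Local Open Scope classical_set_scope.
Local Open Scope ring_scope.
Set Implicit Arguments.
Unset Strict Implicit.
Unset Printing Implicit Defensive.

(** * Translations and reflections; sections of null sets *)

(** The ansatz is a superposition. The Sonine condition at [s] sends [w(s, t) k(t - s)] to
    [g(s, t - s)], a jump of size [g(s, 0)] at [t = s] plus an absolutely continuous tail; the term
    at [s = 0] produces the jump needed at the origin, and the density [phi] cancels the tails. The
    equation for [phi] is used only in integrated form, convolved with 1, so [K * kappa] is never
    differentiated.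

    The obstacle is measurability. [w] and [g] are Borel only up to a null set of the plane, [g_2]
    is not assumed jointly measurable, and the derivative bounds and the Sonine condition hold for
    each [s] and almost every [t], whereas the superposition integrates in [s] at fixed [t]. Hence
    kernels are replaced by Borel functions on the whole plane, cut off so that their bounds hold
    everywhere, and exceptional sets are swapped by Tonelli. The slice [s = 0] may be lost in a null
    set and is treated apart.

    Two further gaps come from the definitions: epsilon-delta absolute continuity must be turned
    into an integral of the derivative, and a distributional derivative into a primitive. *)

Section measure_preserving.
Context {R : realType}.
Local Notation mu := (@lebesgue_measure R).

Lemma aeS (P Q : R -> Prop) : (forall x, P x -> Q x) ->
  {ae mu, forall x, P x} -> {ae mu, forall x, Q x}.
Proof. by move=> PQ; apply: filterS => //; exact: (ae_filter_ringOfSetsType mu). Qed.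

Lemma aeS2 (P P' Q : R -> Prop) : (forall x, P x -> P' x -> Q x) ->
  {ae mu, forall x, P x} -> {ae mu, forall x, P' x} -> {ae mu, forall x, Q x}.
Proof. by move=> PQ; apply: filterS2 => //; exact: (ae_filter_ringOfSetsType mu). Qed.

Lemma aeS3 (P P' P'' Q : R -> Prop) : (forall x, P x -> P' x -> P'' x -> Q x) ->
  {ae mu, forall x, P x} -> {ae mu, forall x, P' x} -> {ae mu, forall x, P'' x} ->
  {ae mu, forall x, Q x}.
Proof. by move=> PQ; apply: filterS3 => //; exact: (ae_filter_ringOfSetsType mu). Qed.

Lemma lebesgue_measure_shift (c : R) (A : set R) : measurable A ->
  pushforward mu (fun x : R => x - c : measurableTypeR R) A = mu A.
Proof.
move=> mA.
have mf : measurable_fun setT (fun x : R => x - c : measurableTypeR R).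
  by apply: measurable_funD => //; exact: measurable_cst.
pose fm := isMeasurableFun.Build _ _ _ _ _ mf.
pose fp : {mfun _ >-> _} := HB.pack (fun x : R => x - c : measurableTypeR R) fm.
rewrite -[LHS]/(pushforward mu fp A).
apply/esym/lebesgue_measure_unique => //= _ [[a b]] _ <-.
rewrite /pushforward /=.
have -> : (fun x : R => x - c) @^-1` `]a, b] = `]a + c, b + c]%classic.
  by apply/seteqP; split => x /=; rewrite !in_itv/= => /andP[xa xb]; apply/andP; split; lra.
rewrite !lebesgue_measure_itv/= !lte_fin ltrD2r; case: ifPn => // _.
by rewrite -!EFinB; congr EFin; lra.
Qed.

Lemma lebesgue_measure_refl (c : R) (A : set R) : measurable A ->
  pushforward mu (fun x : R => c - x : measurableTypeR R) A = mu A.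
Proof.
move=> mA.
have mf : measurable_fun setT (fun x : R => x - - c : measurableTypeR R).
  by apply: measurable_funD => //; exact: measurable_cst.
rewrite -(lebesgue_measure_shift (- c)) // -[RHS]lebesgue_measureN.
  by congr (mu _); apply/seteqP; split => x /=; rewrite opprK addrC.
by rewrite -[X in measurable X]setTI; exact: mf.
Qed.

Lemma ae_shift (c : R) (P : R -> Prop) :
  {ae mu, forall x, P x} -> {ae mu, forall x, P (x - c)}.
Proof.
move=> [N [mN N0 PN]].
have mf : measurable_fun setT (fun x : R => x - c : measurableTypeR R).
  by apply: measurable_funD => //; exact: measurable_cst.
exists ((fun x : R => x - c) @^-1` N); split.
- by rewrite -[X in measurable X]setTI; exact: mf.
- by rewrite -N0; apply: lebesgue_measure_shift.
- by move=> x; exact: (PN (x - c)).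
Qed.

Lemma ae_refl (c : R) (P : R -> Prop) :
  {ae mu, forall x, P x} -> {ae mu, forall x, P (c - x)}.
Proof.
move=> [N [mN N0 PN]].
have mf : measurable_fun setT (fun x : R => c - x : measurableTypeR R).
  by apply: measurable_funB => //; exact: measurable_cst.
exists ((fun x : R => c - x) @^-1` N); split.
- by rewrite -[X in measurable X]setTI; exact: mf.
- by rewrite -N0; apply: lebesgue_measure_refl.
- by move=> x; exact: (PN (c - x)).
Qed.

Lemma ge0_integral_shift (c : R) (f : R -> \bar R) : measurable_fun setT f ->
  (forall x, 0 <= f x)%E ->
  (\int[mu]_x f (x - c)%R = \int[mu]_x f x)%E.
Proof.
move=> mf f0.
have mg : measurable_fun setT (fun x : R => x - c : measurableTypeR R).
  by apply: measurable_funD => //; exact: measurable_cst.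
pose fm := isMeasurableFun.Build _ _ _ _ _ mg.
pose fp : {mfun _ >-> _} := HB.pack (fun x : R => x - c : measurableTypeR R) fm.
transitivity (\int[pushforward mu fp]_x f x)%E.
  by rewrite ge0_integral_pushforward.
by apply: eq_measure_integral => A mA _; exact: lebesgue_measure_shift.
Qed.

Lemma ge0_integral_refl (c : R) (f : R -> \bar R) : measurable_fun setT f ->
  (forall x, 0 <= f x)%E ->
  (\int[mu]_x f (c - x)%R = \int[mu]_x f x)%E.
Proof.
move=> mf f0.
have mg : measurable_fun setT (fun x : R => c - x : measurableTypeR R).
  by apply: measurable_funB => //; exact: measurable_cst.
pose fm := isMeasurableFun.Build _ _ _ _ _ mg.
pose fp : {mfun _ >-> _} := HB.pack (fun x : R => c - x : measurableTypeR R) fm.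
transitivity (\int[pushforward mu fp]_x f x)%E.
  by rewrite ge0_integral_pushforward.
by apply: eq_measure_integral => A mA _; exact: lebesgue_measure_refl.
Qed.

Lemma integrable_refl (c : R) (f : R -> R) :
  mu.-integrable setT (EFin \o f) -> mu.-integrable setT (EFin \o (fun x => f (c - x))).
Proof.
move=> /integrableP[/measurable_EFinP mf foo].
have mg : measurable_fun setT (fun x : R => f (c - x)).
  by apply: measurableT_comp => //; apply: measurable_funB => //; exact: measurable_cst.
apply/integrableP; split; first exact/measurable_EFinP.
rewrite [ltLHS](_ : _ = \int[mu]_x `|(EFin \o f) x|)%E//.
rewrite -[RHS](ge0_integral_refl c)//.
by apply: measurableT_comp => //; exact/measurable_EFinP.
Qed.

Lemma Rintegral_refl (c : R) (f : R -> R) :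
  mu.-integrable setT (EFin \o f) -> \int[mu]_x f (c - x) = \int[mu]_x f x.
Proof.
move=> If; have /integrableP[/measurable_EFinP mf foo] := If.
have mg : measurable_fun setT (fun x : R => c - x : measurableTypeR R).
  by apply: measurable_funB => //; exact: measurable_cst.
pose fm := isMeasurableFun.Build _ _ _ _ _ mg.
pose fp : {mfun _ >-> _} := HB.pack (fun x : R => c - x : measurableTypeR R) fm.
rewrite /Rintegral; congr fine.
transitivity (\int[pushforward mu fp]_x (f x)%:E)%E.
  rewrite integral_pushforward//; first exact/measurable_EFinP.
  exact: integrable_refl.
by apply: eq_measure_integral => A mA _; exact: lebesgue_measure_refl.
Qed.

Lemma ae_prod_xsection (P : R * R -> Prop) :
  {ae (mu \x mu)%E, forall p, P p} ->
  {ae mu, forall s, {ae mu, forall t, P (s, t)}}.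
Proof.
move=> [N [mN N0 PN]].
have : ae_eq mu setT (mu \o xsection N) (cst 0%E).
  apply/ae_eq_integral_abs => //; first exact: measurable_fun_xsection.
  by rewrite -[RHS]N0; apply: eq_integral => x _; rewrite gee0_abs.
apply: aeS => s /(_ Logic.I) /= s0.
exists (xsection N s); split=> //; first exact: measurable_xsection.
by move=> t nP; rewrite /xsection/= inE; exact: PN.
Qed.

(** The set where [F] and [G] differ is Borel, so Tonelli computes its measure from either family of
    sections. This carries the Sonine condition from each [s] and a.e. [t] to a.e. [t] and a.e.
    [s]. *)
Lemma ae_swap (F G : R * R -> R) :
  measurable_fun setT F -> measurable_fun setT G ->
  {ae mu, forall s, {ae mu, forall t, F (s, t) = G (s, t)}} ->
  {ae mu, forall t, {ae mu, forall s, F (s, t) = G (s, t)}}.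
Proof.
move=> mF mG FG; pose N := [set p : R * R | F p != G p].
have mN : measurable N.
  rewrite [N](_ : _ = (fun p => F p == G p) @^-1` [set false]); last first.
    by apply/seteqP; split => p /=; rewrite /N/=; case: (F p == G p).
  by rewrite -[X in measurable X]setTI; apply: measurable_fun_eqr.
have h1 : (\int[mu]_s mu (xsection N s) = 0)%E.
  have : ae_eq mu setT (mu \o xsection N) (cst 0%E).
    move: FG; apply: aeS => s FGs _ /=.
    apply: measure_negligible; first exact: measurable_xsection.
    move: FGs; apply: negligibleS => t; rewrite /xsection/= inE /N/=.
    by move=> /eqP.
  move=> /(ae_eq_integral_abs mu measurableT (measurable_fun_xsection mu mN)) <-.
  by apply: eq_integral => x _; rewrite gee0_abs.
have h2 : (\int[mu]_t mu (ysection N t) = 0)%E.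
  rewrite -h1.
  have := indic_fubini_tonelli mu mu mN; rewrite indic_fubini_tonelli_FE// indic_fubini_tonelli_GE//.
have : ae_eq mu setT (mu \o ysection N) (cst 0%E).
  apply/ae_eq_integral_abs => //; first exact: measurable_fun_ysection.
  by rewrite -[RHS]h2; apply: eq_integral => x _; rewrite gee0_abs.
apply: aeS => t /(_ Logic.I) /= t0.
exists (ysection N t); split=> //; first exact: measurable_ysection.
by move=> s /= nP; rewrite /ysection/= inE /N/=; apply/eqP.
Qed.

End measure_preserving.

(** * Integral operators dominated by a convolution *)

Section kernel_operators.
Context {R : realType}.
Local Notation mu := (@lebesgue_measure R).
Local Notation intg f := (mu.-integrable setT (EFin \o f)).
Implicit Types (a phi psi f : R -> R) (H : R * R -> R).

Lemma intg_measurable f : intg f -> measurable_fun setT f.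
Proof. by move=> /integrableP[/measurable_EFinP]. Qed.

Lemma intg_le f g : measurable_fun setT f -> (forall x, `|f x| <= g x) ->
  intg g -> intg f.
Proof.
move=> mf fg; apply: le_integrable => //; first exact/measurable_EFinP.
by move=> x _ /=; rewrite lee_fin (le_trans (fg x))// ler_norm.
Qed.

Lemma Rintegral_ae_eq f g : measurable_fun setT f -> measurable_fun setT g ->
  {ae mu, forall x, f x = g x} -> \int[mu]_x f x = \int[mu]_x g x.
Proof.
move=> mf mg fg; congr fine; apply: ae_eq_integral => //; try exact/measurable_EFinP.
by move: fg; apply: aeS => x /= ->.
Qed.

Lemma EFin_Rintegral f : intg f -> (\int[mu]_x f x)%:E = (\int[mu]_x (f x)%:E)%E.
Proof. by move=> If; rewrite fineK//; exact: integrable_fin_num. Qed.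

(** The integral is by definition the difference of those of the positive and negative parts, and
    Tonelli makes each measurable; parameters at which the integral diverges therefore do no
    harm. *)
Lemma measurable_integral_param d (T : measurableType d) (F : T * R -> \bar R) :
  measurable_fun setT F -> measurable_fun setT (fun x => \int[mu]_y F (x, y))%E.
Proof.
move=> mF.
rewrite (_ : (fun x => _) = fun x => (fubini_F mu F^\+ x - fubini_F mu F^\- x)%E); last first.
  apply/funext => x; rewrite [LHS]integralE /fubini_F.
  under eq_integral do rewrite funepos_comp/=.
  by under [X in (_ - X)%E = _]eq_integral do rewrite funeneg_comp/=.
apply: emeasurable_funB; apply: measurable_fun_fubini_tonelli_F => //.
- exact: measurable_funepos.
- exact: measurable_funeneg.
Qed.

Lemma measurable_Rintegral_param d (T : measurableType d) (F : T * R -> R) :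
  measurable_fun setT F -> measurable_fun setT (fun x => \int[mu]_y F (x, y)).
Proof.
move=> mF; rewrite /Rintegral; apply: (measurableT_comp (fine_measurable _)) => //.
by apply: (measurable_integral_param (F := EFin \o F)); exact/measurable_EFinP.
Qed.

Lemma Rfubini (F : R * R -> R) : (mu \x mu)%E.-integrable setT (EFin \o F) ->
  \int[mu]_x (\int[mu]_y F (x, y)) = \int[mu]_y (\int[mu]_x F (x, y)).
Proof.
move=> IF; have mF : measurable_fun setT F by have /integrableP[/measurable_EFinP] := IF.
have mF' : measurable_fun setT (fun p : R * R => F (p.2, p.1)).
  by apply: (measurableT_comp mF); apply: measurable_fun_pair.
congr fine; transitivity (\int[mu]_x \int[mu]_y (F (x, y))%:E)%E.
  apply: ae_eq_integral => //.
  - by apply/measurable_EFinP; exact: measurable_Rintegral_param.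
  - exact: (measurable_fubini_F IF).
  - by have := ae_integrable1 IF; apply: aeS => x /= Ix _; rewrite EFin_Rintegral.
rewrite (Fubini IF); apply: ae_eq_integral => //.
- exact: (measurable_fubini_G IF).
- apply/measurable_EFinP; exact: (measurable_Rintegral_param (F := fun p : R * R => F (p.2, p.1))).
- by have := ae_integrable2 IF; apply: aeS => x /= Ix _; rewrite EFin_Rintegral.
Qed.

Definition kerop H phi (t : R) : R := \int[mu]_s (H (s, t) * phi s).

Definition norm1 f : R := \int[mu]_x `|f x|.

Lemma norm1_ge0 f : 0 <= norm1 f.
Proof. by apply: Rintegral_ge0 => x _; exact: normr_ge0. Qed.

Lemma norm1E f : intg f -> (norm1 f)%:E = (\int[mu]_x `|f x|%:E)%E.
Proof. by move=> If; apply: (EFin_Rintegral (integrable_norm If)). Qed.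

(** A kernel takes the source [s] first and the target [t] second. The bound is required at every
    point and forces [a] to be nonnegative; if [a] vanishes on the negative half-line, then [H] is a
    Volterra kernel. *)
Record convolution_dominated a H : Prop := ConvolutionDominated {
  convolution_dominated_measurable : measurable_fun setT H ;
  convolution_dominated_le : forall s t, `|H (s, t)| <= a (t - s) }.

Section dominated.
Variables (a : R -> R) (H : R * R -> R).
Hypotheses (Ia : intg a) (Ha : convolution_dominated a H).

Let mH : measurable_fun setT H := convolution_dominated_measurable Ha.
Let Hle : forall s t, `|H (s, t)| <= a (t - s) := convolution_dominated_le Ha.
Let a0 x : 0 <= a x.
Proof. by have := Hle 0 x; rewrite subr0; apply: le_trans. Qed.
Let ma : measurable_fun setT a := intg_measurable Ia.

Let mHphi phi : measurable_fun setT phi -> measurable_fun setT (fun p => H p * phi p.1).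
Proof. by move=> mphi; apply: measurable_funM => //; exact: measurableT_comp. Qed.

(** Young's inequality in L^1: for each [s] the inner integral is at most [|phi s|] times the
    translation-invariant norm of [a]. *)
Let iterated_le phi : intg phi ->
  (\int[mu]_s \int[mu]_t `|(H (s, t) * phi s)%:E| <= (norm1 a * norm1 phi)%:E)%E.
Proof.
move=> Iphi; have mphi := intg_measurable Iphi.
rewrite EFinM norm1E// norm1E//.
rewrite -[leRHS]ge0_integralZl//; last 2 first.
- by apply/measurable_EFinP; exact: measurableT_comp.
- by apply: integral_ge0.
apply: ge0_le_integral => //.
- by move=> x _; exact: integral_ge0.
- have := measurable_fun_fubini_tonelli_F (m2 := mu) (fun p => `|(H p * phi p.1)%:E|)%E.
  by apply => //; apply: measurableT_comp => //; apply/measurable_EFinP; exact: mHphi.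
- apply: emeasurable_funM; first exact: measurable_cst.
  by apply/measurable_EFinP; exact: measurableT_comp.
move=> s _.
rewrite -ge0_integralZr//; last first.
  by apply/measurable_EFinP; exact: measurableT_comp.
have -> : (\int[mu]_x (`|a x|%:E * `|phi s|%:E) = \int[mu]_x (`|a (x - s)%R|%:E * `|phi s|%:E))%E.
  symmetry; apply: (ge0_integral_shift s (f := fun x => (`|a x|%:E * `|phi s|%:E)%E)) => //.
  apply: emeasurable_funM; last exact: measurable_cst.
  by apply/measurable_EFinP; exact: measurableT_comp.
apply: ge0_le_integral => //.
- apply: measurableT_comp => //; apply/measurable_EFinP.
  exact: (measurable_fun_pair2 s (mHphi mphi)).
- apply: emeasurable_funM; last exact: measurable_cst.
  apply/measurable_EFinP; apply: measurableT_comp => //; apply: measurableT_comp => //.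
  by apply: measurable_funB => //; exact: measurable_cst.
move=> t _; rewrite -EFinM lee_fin normrM ler_wpM2r//.
by rewrite (le_trans (Hle _ _))// ler_norm.
Qed.

Lemma kerop_integrable2 phi : intg phi ->
  (mu \x mu)%E.-integrable setT (EFin \o (fun p => H p * phi p.1)).
Proof.
move=> Iphi; apply/integrable12ltyP.
  by apply/measurable_EFinP; apply: mHphi; exact: intg_measurable.
by apply: le_lt_trans (iterated_le Iphi) _; rewrite ltry.
Qed.

Lemma kerop_ae_integrable phi : intg phi ->
  {ae mu, forall t, intg (fun s => H (s, t) * phi s)}.
Proof. by move=> Iphi; exact: (ae_integrable2 (kerop_integrable2 Iphi)). Qed.

Lemma measurable_kerop phi : measurable_fun setT phi -> measurable_fun setT (kerop H phi).
Proof.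
move=> mphi; apply: (measurable_Rintegral_param (F := fun p : R * R => H (p.2, p.1) * phi p.2)).
apply: measurable_funM; last exact: measurableT_comp.
by apply: measurableT_comp => //; exact: measurable_fun_pair.
Qed.

Let integral_kerop_le phi : intg phi ->
  (\int[mu]_t `|kerop H phi t|%:E <= (norm1 a * norm1 phi)%:E)%E.
Proof.
move=> Iphi; apply: le_trans (iterated_le Iphi).
have mF := mHphi (intg_measurable Iphi).
have mG : measurable_fun setT (fun p => `|(H p * phi p.1)%:E|)%E.
  by apply: measurableT_comp => //; exact/measurable_EFinP.
have -> := fubini_tonelli (m1 := mu) (m2 := mu) _ mG (fun p => abse_ge0 _).
apply: ge0_le_integral => //.
- by apply/measurable_EFinP; apply: measurableT_comp => //; apply: measurable_kerop; exact: intg_measurable.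
- exact: (measurable_fun_fubini_tonelli_G (m1 := mu) (fun p => `|(H p * phi p.1)%:E|)%E).
move=> t _; apply: le_trans (le_abse_integral _ _ _) => //.
  (* Where the integral is infinite, [fine] returns 0, so passing to [kerop] can only decrease the
     absolute value. *)
  rewrite /kerop /Rintegral; case: (integral _ _ _) => [r| |] //=; rewrite ?normr0 ?leey//.
by apply/measurable_EFinP; exact: (measurable_fun_pair1 t mF).
Qed.

Lemma kerop_integrable phi : intg phi -> intg (kerop H phi).
Proof.
move=> Iphi; apply/integrableP; split.
  by apply/measurable_EFinP; apply: measurable_kerop; exact: intg_measurable.
by apply: le_lt_trans (integral_kerop_le Iphi) _; rewrite ltry.
Qed.

Lemma norm1_kerop_le phi : intg phi -> norm1 (kerop H phi) <= norm1 a * norm1 phi.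
Proof.
move=> Iphi; rewrite -lee_fin norm1E; first exact: integral_kerop_le.
exact: kerop_integrable.
Qed.

Lemma keropB phi psi : intg phi -> intg psi ->
  {ae mu, forall t, kerop H (phi \- psi) t = kerop H phi t - kerop H psi t}.
Proof.
move=> Iphi Ipsi; move: (kerop_ae_integrable Iphi) (kerop_ae_integrable Ipsi).
apply: aeS2 => t It1 It2; rewrite /kerop -RintegralB//.
by apply: eq_Rintegral => s _ /=; rewrite mulrBr.
Qed.

Lemma keropD phi psi : intg phi -> intg psi ->
  {ae mu, forall t, kerop H (phi \+ psi) t = kerop H phi t + kerop H psi t}.
Proof.
move=> Iphi Ipsi; move: (kerop_ae_integrable Iphi) (kerop_ae_integrable Ipsi).
apply: aeS2 => t It1 It2; rewrite /kerop -RintegralD//.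
by apply: eq_Rintegral => s _ /=; rewrite mulrDr.
Qed.

Lemma keropZ (c : R) phi : intg phi ->
  {ae mu, forall t, kerop H (fun s => c * phi s) t = c * kerop H phi t}.
Proof.
move=> Iphi; move: (kerop_ae_integrable Iphi).
apply: aeS => t It1; rewrite /kerop -RintegralZl//.
by apply: eq_Rintegral => s _ /=; rewrite mulrCA.
Qed.

End dominated.

Lemma eq_kerop H phi psi t : measurable_fun setT H ->
  measurable_fun setT phi -> measurable_fun setT psi ->
  {ae mu, forall s, phi s = psi s} -> kerop H phi t = kerop H psi t.
Proof.
move=> mH mphi mpsi e; apply: Rintegral_ae_eq.
- by apply: measurable_funM => //; exact: (measurable_fun_pair1 t mH).
- by apply: measurable_funM => //; exact: (measurable_fun_pair1 t mH).
- by move: e; apply: aeS => s ->.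
Qed.

Definition kercomp H1 H2 (p : R * R) : R := \int[mu]_r (H1 (r, p.2) * H2 (p.1, r)).

Lemma measurable_kercomp H1 H2 : measurable_fun setT H1 -> measurable_fun setT H2 ->
  measurable_fun setT (kercomp H1 H2).
Proof.
move=> m1 m2; apply: (measurable_Rintegral_param
  (F := fun q : (R * R) * R => H1 (q.2, q.1.2) * H2 (q.1.1, q.2))).
apply: measurable_funM.
- apply: (measurableT_comp m1); apply: measurable_fun_pair => //.
  by apply: measurableT_comp => //; exact: measurable_fst.
- apply: (measurableT_comp m2); apply: measurable_fun_pair => //.
  by apply: measurableT_comp => //; exact: measurable_fst.
Qed.

Lemma convolution_dominated_shift a : measurable_fun setT a -> (forall x, 0 <= a x) ->
  convolution_dominated a (fun p => a (p.2 - p.1)).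
Proof.
move=> ma a0; split; last by move=> s t /=; rewrite ger0_norm.
by apply: (measurableT_comp ma); apply: measurable_funB.
Qed.

(** Fubini at a fixed [t]. Absolute integrability is inherited from the dominating convolutions:
    [a1 * (a2 * |phi|)] is finite for a.e. [t] because [a2 * |phi|] is integrable. *)
Lemma kerop_comp a1 a2 H1 H2 phi : intg a1 -> intg a2 ->
  convolution_dominated a1 H1 -> convolution_dominated a2 H2 -> intg phi ->
  {ae mu, forall t, kerop H1 (kerop H2 phi) t = kerop (kercomp H1 H2) phi t}.
Proof.
move=> I1 I2 D1 D2 Iphi; have [m1 le1] := D1; have [m2 le2] := D2.
have a10 x : 0 <= a1 x by have := le1 0 x; rewrite subr0; apply: le_trans.
have a20 x : 0 <= a2 x by have := le2 0 x; rewrite subr0; apply: le_trans.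
have mphi := intg_measurable Iphi.
pose A1 := fun p : R * R => a1 (p.2 - p.1).
pose A2 := fun p : R * R => a2 (p.2 - p.1).
have DA1 : convolution_dominated a1 A1.
  by apply: convolution_dominated_shift => //; exact: intg_measurable.
have DA2 : convolution_dominated a2 A2.
  by apply: convolution_dominated_shift => //; exact: intg_measurable.
have Inphi : intg (fun s => `|phi s|) by exact: integrable_norm.
have IP := kerop_integrable I2 DA2 Inphi.
have aeP := kerop_ae_integrable I2 DA2 Inphi.
have ae2 := kerop_ae_integrable I2 D2 Iphi.
move: (kerop_ae_integrable I1 DA1 IP).
apply: aeS => t It.
pose F := fun p : R * R => H1 (p.1, t) * (H2 (p.2, p.1) * phi p.2).
have mF : measurable_fun setT F.
  apply: measurable_funM.
    by apply: (measurableT_comp m1); exact: measurable_fun_pair.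
  apply: measurable_funM; last exact: measurableT_comp.
  by apply: (measurableT_comp m2); exact: measurable_fun_pair.
have IF : (mu \x mu)%E.-integrable setT (EFin \o F).
  apply/integrable12ltyP; first exact/measurable_EFinP.
  apply: (@le_lt_trans _ _ (\int[mu]_r (A1 (r, t) * kerop A2 (fun s => `|phi s|) r)%:E)%E); last first.
    by have := integrable_lty measurableT It; apply.
  apply: ae_ge0_le_integral => //.
  - by move=> r _; exact: integral_ge0.
  - apply: (measurable_fun_fubini_tonelli_F (m2 := mu) (fun p => `|(F p)%:E|)%E) => //.
    by apply: measurableT_comp => //; exact/measurable_EFinP.
  - move=> r _; rewrite lee_fin mulr_ge0//; first exact: a10.
    by apply: Rintegral_ge0 => s _; rewrite mulr_ge0//; exact: a20.
  - by have /integrableP[] := It.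
  move: aeP; apply: aeS => r Ir _.
  rewrite EFinM EFin_Rintegral// -ge0_integralZl//; last 3 first.
  - by have /integrableP[] := Ir.
  - by move=> s _; rewrite lee_fin mulr_ge0//; exact: a20.
  - by rewrite lee_fin; exact: a10.
  apply: ge0_le_integral => //.
  - apply: measurableT_comp => //; apply/measurable_EFinP.
    exact: (measurable_fun_pair2 r mF).
  - apply: emeasurable_funM => //; by have /integrableP[] := Ir.
  - move=> s _; rewrite lee_fin /F/= !normrM ler_pM// ?mulr_ge0//.
    by rewrite ler_pM.
transitivity (\int[mu]_r \int[mu]_s F (r, s)).
  apply: Rintegral_ae_eq.
  - apply: measurable_funM; first exact: (measurable_fun_pair1 t m1).
    exact: measurable_kerop.
  - exact: measurable_Rintegral_param.
  - move: ae2; apply: aeS => r Ir; rewrite /F /kerop /= RintegralZl//.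
rewrite Rfubini//; apply: Rintegral_ae_eq.
- apply: (measurable_Rintegral_param (F := fun p : R * R => F (p.2, p.1))).
  by apply: (measurableT_comp mF); exact: measurable_fun_pair.
- apply: measurable_funM => //.
  exact: (measurable_fun_pair1 t (measurable_kercomp m1 m2)).
- have := ae_integrable2 IF; apply: aeS => s Is.
  rewrite /F/= /kercomp /=.
  (* Fubini gives integrability in [r] of the product that contains [phi s]. Dividing by [phi s]
     gives that of the composed kernel; where [phi s = 0] the latter may diverge, but both sides are
     0. *)
  have [ps0|ps0] := eqVneq (phi s) 0.
    rewrite ps0 mulr0; under eq_Rintegral do rewrite !mulr0.
    by rewrite Rintegral_cst// mul0r.
  rewrite -RintegralZr//; first by apply: eq_Rintegral => r _; rewrite mulrA.
  apply: (@eq_integrable _ _ _ mu _ measurableT (fun r => ((phi s)^-1)%:E * (F (r, s))%:E)%E).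
    by move=> r _ /=; rewrite -EFinM /F/=; congr EFin; field.
  exact: integrableZl.
Qed.

End kernel_operators.

(** * Second-kind Volterra equations *)

Section second_kind.
Context {R : realType}.
Local Notation mu := (@lebesgue_measure R).
Local Notation intg f := (mu.-integrable setT (EFin \o f)).
Implicit Types (a phi psi f g : R -> R) (H : R * R -> R).

Lemma intgD f g : intg f -> intg g -> intg (f \+ g).
Proof. by move=> If Ig; apply: (integrableD measurableT If Ig). Qed.

Lemma intgB f g : intg f -> intg g -> intg (f \- g).
Proof. by move=> If Ig; apply: (integrableB measurableT If Ig). Qed.

Lemma intgN f : intg f -> intg (fun x => - f x).
Proof. by move=> If; apply: (integrableN If). Qed.

Lemma intgZ (c : R) f : intg f -> intg (fun x => c * f x).
Proof. by move=> If; apply: (integrableZl measurableT c If). Qed.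

Lemma norm1D f g : intg f -> intg g -> norm1 (f \+ g) <= norm1 f + norm1 g.
Proof.
move=> If Ig; rewrite /norm1 -RintegralD//; try exact: integrable_norm.
apply: le_Rintegral => //.
- exact: (integrable_norm (intgD If Ig)).
- by apply: intgD; exact: integrable_norm.
- by move=> x _ /=; exact: ler_normD.
Qed.

Lemma eq_norm1 f g : measurable_fun setT f -> measurable_fun setT g ->
  {ae mu, forall x, f x = g x} -> norm1 f = norm1 g.
Proof.
move=> mf mg fg; apply: Rintegral_ae_eq; try exact: measurableT_comp.
by move: fg; apply: aeS => x ->.
Qed.

Lemma norm1_eq0 f : intg f -> norm1 f = 0 -> {ae mu, forall x, f x = 0}.
Proof.
move=> If f0; have : (\int[mu]_x `|(EFin \o f) x| = 0)%E by rewrite -[RHS](congr1 EFin f0) norm1E.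
move/(ae_eq_integral_abs mu measurableT) => h.
have := h (measurable_int _ If); apply: aeS => x /= /(_ Logic.I) [].
by [].
Qed.

Lemma norm1N f : norm1 (fun x => - f x) = norm1 f.
Proof. by apply: eq_Rintegral => x _; rewrite normrN. Qed.

(** The Neumann series [u n = (- H)^n psi]. Its norms are dominated by a geometric series, so the
    sum [B] of the absolute values is integrable; it gives a.e. convergence and, by dominated
    convergence, convergence in L^1. *)
Lemma kerop_contraction_solution a H psi : intg a -> convolution_dominated a H ->
  norm1 a < 1 -> intg psi ->
  exists2 phi, intg phi & {ae mu, forall t, phi t + kerop H phi t = psi t}.
Proof.
move=> Ia Ha a1 Ipsi.
pose u := fix u n : R -> R := if n is m.+1 then (fun t => - kerop H (u m) t) else psi.
have Iu n : intg (u n).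
  by elim: n => [//|n IH]; apply: intgN; exact: (kerop_integrable Ia Ha IH).
have mu_ n : measurable_fun setT (u n) := intg_measurable (Iu n).
set rho := norm1 a; set N := norm1 psi.
have r0 : 0 <= rho by exact: norm1_ge0.
have nu n : norm1 (u n) <= rho ^+ n * N.
  elim: n => [|n IH]; first by rewrite expr0 mul1r.
  rewrite exprS -mulrA (le_trans _ (ler_wpM2l r0 IH))//= norm1N.
  exact: norm1_kerop_le.
pose S n t := \sum_(i < n) u i t.
have IS n : intg (S n).
  rewrite (_ : _ \o _ = fun t => \sum_(i < n) (u i t)%:E)%E; last first.
    by apply/funext => t; rewrite /= sumEFin.
  by apply: integrable_sum => // i _; exact: Iu.
have ST n : {ae mu, forall t, S n t + kerop H (S n) t = psi t - u n t}.
  elim: n => [|n IH].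
    apply: aeW => t; rewrite /S big_ord0 /= subrr add0r /kerop.
    under eq_Rintegral do rewrite big_ord0 mulr0.
    by rewrite Rintegral_cst// mul0r.
  have Sn : S n.+1 = S n \+ u n by apply/funext => t; rewrite /S big_ord_recr.
  move: IH (keropD Ia Ha (IS n) (Iu n)); apply: aeS2 => t IH.
  by rewrite Sn => -> /=; rewrite opprK addrACA IH; lra.
pose B t := (\sum_(i <oo) `|u i t|%:E)%E.
have mB : measurable_fun setT B.
  apply: ge0_emeasurable_sum => [k x _ _|k _]; first by rewrite lee_fin.
  by apply/measurable_EFinP; exact: measurableT_comp.
have B0 t : (0 <= B t)%E by apply: nneseries_ge0 => n _ _; rewrite lee_fin.
have IB : mu.-integrable setT B.
  apply/integrableP; split => //.
  under eq_integral do rewrite gee0_abs//.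
  rewrite /B integral_nneseries//; last first.
    by move=> n; apply/measurable_EFinP; apply: measurableT_comp => //; exact: mu_.
  apply: (@le_lt_trans _ _ ((1 - rho)^-1 * N)%:E); last by rewrite ltry.
  apply: lime_le; first by apply: is_cvg_nneseries => n _ _; exact: integral_ge0.
  apply: nearW => n.
  apply: (@le_trans _ _ (\sum_(0 <= i < n) (rho ^+ i * N)%:E)%E).
    by apply: lee_sum => i _; rewrite -norm1E// lee_fin.
  rewrite sumEFin lee_fin -mulr_suml ler_wpM2r ?norm1_ge0//.
  rewrite -[leRHS]mul1r ler_pdivlMr ?subr_gt0//.
  have -> : (\sum_(0 <= i < n) rho ^+ i) * (1 - rho) = 1 - rho ^+ n.
    by rewrite big_mkord -[1 - rho ^+ n]opprB subrX1 -mulNr opprB mulrC.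
  by rewrite lerBlDr lerDl exprn_ge0.
(* The upper limit is a Borel function defined everywhere, including the null set on which the
   series may diverge. *)
pose phi t := fine (limn_esup (fun n => (S n t)%:E)).
have mphi : measurable_fun setT phi.
  apply: (measurableT_comp (fine_measurable _)) => //.
  apply: (measurable_fun_limn_esup (f := fun n t => (S n t)%:E)) => n.
  by have /integrableP[] := IS n.
have SB n t : (`|(S n t)%:E| <= B t)%E.
  apply: (@le_trans _ _ (\sum_(0 <= i < n) `|u i t|%:E)%E).
    by rewrite sumEFin lee_fin /S big_mkord; exact: ler_norm_sum.
  by apply: nneseries_lim_ge => i _ _; rewrite lee_fin.
have Sphi : {ae mu, forall t, S ^~ t @ \oo --> phi t}.
  have := integrable_ae measurableT IB; apply: aeS => t /(_ Logic.I) Bfin.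
  have cS : cvgn (S ^~ t).
    rewrite (_ : S ^~ t = series (u ^~ t)); last first.
      by apply/funext => n; rewrite /S /series/= big_mkord.
    apply: normed_cvg; apply: nondecreasing_is_cvgn.
      apply/nondecreasing_seqP => n.
      by rewrite /normed_series_of /series/= big_nat_recr//= lerDl.
    exists (fine (B t)) => _ [n _ <-]; rewrite -lee_fin fineK//.
    rewrite /normed_series_of /series/= -sumEFin.
    by apply: nneseries_lim_ge => i _ _; rewrite lee_fin.
  have /cvg_ex[/= l Sl] := cS.
  have El : (fun n => (S n t)%:E) @ \oo --> l%:E by apply: cvg_EFin => //; exact: nearW.
  rewrite /phi is_cvg_limn_esupE; last by apply/cvg_ex; exists l%:E.
  by rewrite (cvg_lim _ El).
have mEphi : measurable_fun setT (EFin \o phi) by exact/measurable_EFinP.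
have dB : {ae mu, forall t n, setT t -> (`|(S n t)%:E| <= B t)%E}.
  by apply: aeW => t n _; exact: SB.
have cSphi : {ae mu, forall t, setT t -> (fun n => (S n t)%:E) @ \oo --> (phi t)%:E}.
  by move: Sphi; apply: aeS => t St _; apply: cvg_EFin => //; exact: nearW.
have [Iphi cphi _] := dominated_convergence measurableT
  (fun n => measurable_int _ (IS n)) mEphi cSphi IB dB.
have {}cphi : (fun n => norm1 (phi \- S n)) @ \oo --> 0.
  rewrite [X in X @ _](_ : _ = fine \o (fun n => \int[mu]_x `|(S n x)%:E - (phi x)%:E|)%E).
    exact: fine_cvg.
  apply/funext => n /=; congr fine; apply: eq_integral => x _ /=.
  by rewrite distrC.
exists phi => //.
(* The residual. Subtracting the identity satisfied by the partial sums bounds its norm by a null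
   sequence. *)
pose D t := phi t + kerop H phi t - psi t.
have ID : intg D by apply: intgB => //; apply: intgD => //; exact: (kerop_integrable Ia Ha).
have Dle n : norm1 D <= (1 + rho) * norm1 (phi \- S n) + rho ^+ n * N.
  have IpS : intg (phi \- S n) by exact: intgB.
  have IkpS := kerop_integrable Ia Ha IpS.
  have IE := intgD (intgD IpS IkpS) (intgN (Iu n)).
  have -> : norm1 D = norm1 (((phi \- S n) \+ kerop H (phi \- S n)) \+ (fun t => - u n t)).
    apply: eq_norm1; [exact: intg_measurable|exact: intg_measurable|].
    move: (ST n) (keropB Ia Ha Iphi (IS n)); apply: aeS2 => t e1 e2.
    by rewrite /= e2 /D; lra.
  apply: le_trans (norm1D (intgD IpS IkpS) (intgN (Iu n))) _.
  rewrite norm1N lerD//.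
  apply: le_trans (norm1D IpS IkpS) _.
  by rewrite mulrDl mul1r lerD2l; exact: norm1_kerop_le.
have D0 : norm1 D = 0.
  apply/eqP; rewrite eq_le norm1_ge0 andbT.
  have : (fun n => (1 + rho) * norm1 (phi \- S n) + rho ^+ n * N) @ \oo --> (1 + rho) * 0 + 0 * N.
    apply: cvgD; first by apply: cvgM => //; exact: cvg_cst.
    apply: cvgM; last exact: cvg_cst.
    by apply: cvg_expr; rewrite ger0_norm.
  rewrite mulr0 mul0r addr0 => c.
  by apply: (cvgr_to_ge c); apply: nearW => n; exact: Dle.
by have := norm1_eq0 ID D0; apply: aeS => t; rewrite /D => /eqP; rewrite subr_eq0 => /eqP.
Qed.

Lemma measurable_expR_comp d (T : measurableType d) (g : T -> R) :
  measurable_fun setT g -> measurable_fun setT (fun x => expR (g x)).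
Proof. by move=> mg; exact: measurableT_comp. Qed.

(** Dominated convergence: on the support of [a] one has [x > 0], where the weights are at most 1
    and tend to 0. *)
Lemma exp_weight_norm1_lt1 a : intg a -> (forall x : R, x <= 0 -> a x = 0) ->
  exists n : nat, norm1 (fun x : R => expR (- (n%:R * x)) * a x) < 1.
Proof.
move=> Ia a0; pose f (n : nat) (x : R) := expR (- (n%:R * x)) * a x.
have ma := intg_measurable Ia.
have mf n : measurable_fun setT (f n).
  apply: measurable_funM => //; apply: measurable_expR_comp.
  by apply: measurableT_comp => //; apply: measurable_funM => //; exact: measurable_cst.
have fa n x : `|f n x| <= `|a x|.
  rewrite normrM; have [x0|x0] := leP x 0; first by rewrite a0// normr0 mulr0.
  rewrite -[leRHS]mul1r ler_wpM2r// ger0_norm ?expR_ge0//.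
  by rewrite -expR0 ler_expR oppr_le0 mulr_ge0// ltW.
have f0 x : f ^~ x @ \oo --> 0.
  have [x0|x0] := leP x 0.
    rewrite (_ : f ^~ x = cst 0); first exact: cvg_cst.
    by apply/funext => n; rewrite /f a0// mulr0.
  rewrite -[X in _ --> X](mul0r (a x)); apply: cvgM; last exact: cvg_cst.
  have -> : (fun n : nat => expR (- (n%:R * x))) = (fun n => expR (- x) ^+ n).
    by apply/funext => n; rewrite -expRM_natl mulrN.
  apply: cvg_expr; rewrite ger0_norm ?expR_ge0//.
  by rewrite -expR0 ltr_expR oppr_lt0.
have c0 : {ae mu, forall x, setT x -> (fun n => (f n x)%:E) @ \oo --> (cst 0%E : R -> \bar R) x}.
  by apply: aeW => x _; apply: cvg_EFin; [exact: nearW|exact: f0].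
have dB : {ae mu, forall x n, setT x -> (`|(f n x)%:E| <= `|a x|%:E)%E}.
  by apply: aeW => x n _; rewrite /= lee_fin.
have mEf n : measurable_fun setT (fun x => (f n x)%:E) by exact/measurable_EFinP.
have [_ + _] := @dominated_convergence _ _ R mu setT measurableT
  (fun n x => (f n x)%:E) (cst 0%E) (fun x => `|a x|%:E) mEf (measurable_cst _)
  c0 (integrable_norm Ia) dB.
move=> /fine_cvgP[_] /cvgr_lt /(_ 1 ltr01) [n _ /(_ n (leqnn n))].
rewrite /= => h; exists n; apply: le_lt_trans h.
rewrite le_eqVlt; apply/orP; left; apply/eqP; congr fine.
by apply: eq_integral => x _ /=; rewrite subr0.
Qed.

(** Conjugation by [expR (- n t)] multiplies the kernel by [expR (- n (t - s))], hence its
    dominating function by [expR (- n x)], and leaves a contraction. Undoing it preserves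
    integrability only on a bounded interval, so the solution is cut to (0, b). For [t < b] this
    changes nothing: [H (s, t)] vanishes for [s <= 0] and, through [a], for [s >= b]. *)
Lemma second_kind_volterra_solution (b : R) a H psi : 0 < b -> intg a ->
  convolution_dominated a H -> (forall x : R, x <= 0 -> a x = 0) ->
  (forall s t : R, s <= 0 -> H (s, t) = 0) -> intg psi -> (forall t : R, t <= 0 -> psi t = 0) ->
  exists phi, [/\ intg phi, forall t : R, ~~ (0 < t < b) -> phi t = 0 &
    {ae mu, forall t, 0 < t < b -> phi t + kerop H phi t = psi t}].
Proof.
move=> b0 Ia Ha a0 H0 Ipsi psi0.
have [n n1] := exp_weight_norm1_lt1 Ia a0.
have [mH leH] := Ha.
have mexp (c : R) : measurable_fun setT (fun x : R => expR (c * x)).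
  by apply: measurable_expR_comp; apply: measurable_funM => //; exact: measurable_cst.
pose al (x : R) := expR (- (n%:R * x)) * a x.
pose Hl (p : R * R) := expR (- (n%:R * (p.2 - p.1))) * H p.
pose psil (t : R) := expR (- (n%:R * t)) * psi t.
have e1 (x : R) : 0 <= x -> expR (- (n%:R * x)) <= 1.
  by move=> x0; rewrite -expR0 ler_expR oppr_le0 mulr_ge0.
have wI f : intg f -> (forall x : R, x <= 0 -> f x = 0) -> intg (fun x : R => expR (- (n%:R * x)) * f x).
  move=> If f0; apply: (intg_le (g := fun x => `|f x|)).
  - apply: measurable_funM; last exact: intg_measurable.
    rewrite (_ : (fun _ => _) = fun x => expR (- n%:R * x)); first exact: mexp.
    by apply/funext => x; rewrite mulNr.
  - move=> x; have [x0|x0] := leP x 0; first by rewrite f0// mulr0 normr0.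
    rewrite normrM -[leRHS]mul1r ler_wpM2r// ger0_norm ?expR_ge0//.
    by apply: e1; exact: ltW.
  - exact: integrable_norm.
have Hal : convolution_dominated al Hl.
  split.
    apply: measurable_funM => //; apply: measurable_expR_comp.
    by apply: measurableT_comp => //; apply: measurable_funM => //; exact: measurable_funB.
  move=> s t; rewrite /Hl /al /= normrM ger0_norm ?expR_ge0// ler_wpM2l ?expR_ge0//.
have [phil Iphil phile] := kerop_contraction_solution (wI _ Ia a0) Hal n1 (wI _ Ipsi psi0).
pose I := `]0, b[%classic : set R.
pose phi := (fun t : R => expR (n%:R * t) * phil t) \_ I.
have mphi : measurable_fun setT phi.
  have mg : measurable_fun I (fun t : R => expR (n%:R * t) * phil t).
    by apply: measurable_funTS; apply: measurable_funM => //; exact: intg_measurable.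
  exact: (measurable_restrictT _ (measurable_itv `]0, b[)).1 mg.
exists phi; split.
- apply: (intg_le (g := fun x => expR (n%:R * b) * `|phil x|)) => //.
  + move=> x; rewrite /phi patchE; case: ifPn => [|_].
      rewrite inE /I/= in_itv/= => /andP[x0 xb].
      rewrite normrM ger0_norm ?expR_ge0// ler_wpM2r// ler_expR.
      by rewrite ler_wpM2l// ltW.
    by rewrite normr0 mulr_ge0// expR_ge0.
  + by apply: intgZ; exact: integrable_norm.
- move=> t nt; rewrite /phi patchE ifF//; apply/negbTE/negP; rewrite inE /I/= in_itv/=.
  exact/negP.
- move: phile (kerop_ae_integrable (wI _ Ia a0) Hal Iphil).
  apply: aeS2 => t e It /andP[t0 tb].
  have phiE s : 0 < s -> s < b -> phi s = expR (n%:R * s) * phil s.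
    by move=> s0 sb; rewrite /phi patchE ifT// inE /I/= in_itv/= s0.
  have -> : psi t = expR (n%:R * t) * (expR (- (n%:R * t)) * psi t).
    by rewrite mulrA -expRD subrr expR0 mul1r.
  rewrite phiE// -e mulrDr; congr (_ + _).
  rewrite /kerop -RintegralZl//; apply: eq_Rintegral => s _; rewrite /Hl/=.
  have [s0|s0] := leP s 0; first by rewrite H0// !(mul0r, mulr0).
  have [sb|sb] := leP b s.
    have -> : H (s, t) = 0.
      apply/eqP; rewrite -normr_le0 (le_trans (leH _ _))// a0//.
      by rewrite subr_le0 (le_trans _ sb)// ltW.
    by rewrite !(mul0r, mulr0).
  rewrite phiE// !mulrA -expRD; congr (_ * _); rewrite mulrC; congr (expR _ * _).
  by ring.
Qed.

End second_kind.

(** * Absolutely continuous functions are integrals of their derivatives *)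

Section absolutely_continuous_variation.
Context {R : realType}.
Implicit Types (F G : R -> R).

(* Absolute continuity on the whole line, with families of intervals indexed by
   an arbitrary finite type, which spares re-indexing unions of families. *)
Definition ac_line F : Prop := forall e : R, 0 < e -> exists2 d : R, 0 < d &
  forall (T : finType) (I : T -> R * R), (forall i, (I i).1 <= (I i).2) ->
    trivIset setT (fun i => `](I i).1, (I i).2[%classic) ->
    \sum_i ((I i).2 - (I i).1) < d -> \sum_i `|F (I i).2 - F (I i).1| < e.

Definition clamp (a c x : R) : R := Num.max a (Num.min x c).

Lemma clamp_itv a c x : a <= c -> a <= clamp a c x <= c.
Proof. by move=> ac; rewrite /clamp le_max lexx ge_max ac ge_min lexx orbT. Qed.

Lemma clamp_id a c x : a <= x <= c -> clamp a c x = x.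
Proof. by move=> /andP[ax xc]; rewrite /clamp min_l// max_r. Qed.

Lemma clamp_le a c x y : x <= y -> clamp a c x <= clamp a c y.
Proof.
move=> xy; rewrite /clamp /Num.max /Num.min.
by do ![case: ifPn]; rewrite -?leNgt => *; lra.
Qed.

Lemma clamp_contract a c x y : x <= y -> clamp a c y - clamp a c x <= y - x.
Proof.
move=> xy; rewrite /clamp /Num.max /Num.min.
by do ![case: ifPn]; rewrite -?leNgt => *; lra.
Qed.

Lemma max_contract (a x y : R) : x <= y -> Num.max a y - Num.max a x <= y - x.
Proof.
move=> xy; have [ma mx] : a <= Num.max a x /\ x <= Num.max a x.
  by rewrite !le_max !lexx orbT.
by rewrite lerBlDr ge_max; apply/andP; split; lra.
Qed.

(** Clamping is a monotone contraction: it does not lengthen intervals and keeps a disjoint family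
    disjoint. *)
Lemma ac_line_clamp a c F : a <= c -> absolutely_continuous_on a c F ->
  ac_line (F \o clamp a c).
Proof.
move=> ac Fac e e0; have [d d0 Fd] := Fac e e0; exists d => // T I I12 tI Id.
pose J (i : 'I_#|T|) := (clamp a c (I (enum_val i)).1, clamp a c (I (enum_val i)).2).
have := Fd _ J; rewrite /J /=.
rewrite -(big_enum_val (fun i => clamp a c (I i).2 - clamp a c (I i).1)).
rewrite -(big_enum_val (fun i => `|F (clamp a c (I i).2) - F (clamp a c (I i).1)|)).
apply.
- move=> i; split; last by have /andP[] := clamp_itv (I (enum_val i)).2 ac.
    by have /andP[] := clamp_itv (I (enum_val i)).1 ac.
  exact: clamp_le.
- move=> i j _ _ [x /= []]; rewrite !in_itv/= => /andP[ix xi] /andP[jx xj].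
  apply: enum_val_inj; apply: tI => //.
  (* A point strictly between two clamped endpoints lies strictly between the original ones. *)
  have h u v : clamp a c u < x -> x < clamp a c v -> u < x < v.
    rewrite gt_max gt_min lt_max lt_min => /andP[ax /orP uc] /orP vc.
    apply/andP; split.
    - case: uc => // cx; case: vc => [xa|/andP[_ xc]].
        by have := lt_trans ax xa; rewrite ltxx.
      by have := lt_trans cx xc; rewrite ltxx.
    - case: vc => [xa|/andP[]//].
      by have := lt_trans ax xa; rewrite ltxx.
  by exists x; split; rewrite /= in_itv/=; apply: h.
- by apply: le_lt_trans Id; apply: ler_sum => i _; exact: clamp_contract.
Qed.

Lemma ac_line_dist F : ac_line F -> forall e : R, 0 < e ->
  exists2 d : R, 0 < d & forall x y, x <= y -> y - x < d -> `|F y - F x| < e.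
Proof.
move=> Fac e e0; have [d d0 Fd] := Fac e e0; exists d => // x y xy yx.
have := Fd unit (fun=> (x, y)); rewrite !big_const card_unit/= !addr0; apply => //.
by move=> [] [].
Qed.

Lemma ac_line_continuous F : ac_line F -> continuous F.
Proof.
move=> Fac x; apply/cvgrPdist_lt => e e0.
have [d d0 Fd] := ac_line_dist Fac e0.
near=> y; have [xy|xy] := leP x y.
- rewrite distrC; apply: Fd => //.
  have : `|x - y| < d by near: y; exact: cvgr_dist_lt.
  by rewrite distrC; apply: le_lt_trans; exact: ler_norm.
- apply: Fd; first exact: ltW.
  have : `|x - y| < d by near: y; exact: cvgr_dist_lt.
  by apply: le_lt_trans; exact: ler_norm.
Unshelve. all: by end_near. Qed.

Lemma ac_lineB F G : ac_line F -> ac_line G -> ac_line (F \- G).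
Proof.
move=> Fac Gac e e0; have e20 : 0 < e / 2 by rewrite divr_gt0.
have [d1 d10 h1] := Fac _ e20; have [d2 d20 h2] := Gac _ e20.
exists (Num.min d1 d2); first by rewrite lt_min d10.
move=> T I I12 tI; rewrite lt_min => /andP[l1 l2].
rewrite [e]splitr; apply: le_lt_trans (ltrD (h1 T I I12 tI l1) (h2 T I I12 tI l2)).
rewrite -big_split/=; apply: ler_sum => i _.
by apply: le_trans (ler_normB _ _); rewrite le_eqVlt; apply/orP; left; apply/eqP; congr `|_|; ring.
Qed.

Lemma variation_sum_nodes F (x y : R) (s : seq R) : itv_partition x y s ->
  exists p : nat -> R, [/\ p 0%N = x, {homo p : i j / (i <= j)%N >-> i <= j},
    forall k, p k <= y &
    forall M, (size s <= M)%N -> variation x y F s = \sum_(k < M) `|F (p k.+1) - F (p k)|].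
Proof.
move=> xys; pose p k := nth y (x :: s) k; exists p.
have pE k : (size s <= k)%N -> p k = y.
  rewrite leq_eqVlt => /predU1P[<-|sk].
    exact: (itv_partition_nth_size y xys).
  by rewrite /p nth_default.
have pS k : p k <= p k.+1.
  have [ks|sk] := ltnP k (size s); last by rewrite !pE// leqW.
  by have [/(pathP y)/(_ k ks)/ltW] := xys.
split => //.
- by apply: homo_leq => //; exact: le_trans.
- by move=> k; have [ks|sk] := ltnP k (size s).+1;
    [exact: itv_partition_nth_le|rewrite pE// ltnW].
- move=> M sM; rewrite /variation big_mkord.
  rewrite -(subnKC sM) big_split_ord/= [X in _ = _ + X]big1 ?addr0// => i _.
  by rewrite !pE ?leq_addr// ?subrr ?normr0// leqW// leq_addr.
Qed.

Lemma nodes_trivIset (p : nat -> R) (i j : nat) (z : R) :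
  {homo p : i j / (i <= j)%N >-> i <= j} ->
  p i < z -> z < p i.+1 -> p j < z -> z < p j.+1 -> i = j.
Proof.
move=> pm iz zi jz zj; apply/eqP; rewrite eqn_leq; apply/andP; split; rewrite leqNgt; apply/negP.
- by move=> /pm h; move: (lt_trans (lt_le_trans zj h) iz); rewrite ltxx.
- by move=> /pm h; move: (lt_trans (lt_le_trans zi h) jz); rewrite ltxx.
Qed.

Local Notation TV := (@total_variation R).

(** Intervals shorter than the [d] that belongs to [e = 1] have variation at most 1, and finitely
    many steps of length [d / 2] cover a bounded interval. *)
Lemma ac_line_total_variation_fin F : ac_line F -> forall x y, x <= y -> TV x y F \is a fin_num.
Proof.
move=> Fac; have [d d0 Fd] := Fac 1 ltr01.
have step x y : x <= y -> y - x < d -> (TV x y F <= 1%:E)%E.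
  move=> xy yx; apply: ge_ereal_sup => _ [_ [s xys <-] <-].
  have [p [p0 pm py pv]] := variation_sum_nodes F xys.
  rewrite (pv _ (leqnn _)) lee_fin ltW//.
  apply: (Fd _ (fun k : 'I_(size s) => (p k, p k.+1))) => /=.
  - by move=> k; exact: pm.
  - move=> i j _ _ [z /= []]; rewrite !in_itv/= => /andP[iz zi] /andP[jz zj].
    by apply: val_inj => /=; exact: (nodes_trivIset pm iz zi jz zj).
  - rewrite -(big_mkord xpredT (fun k => p k.+1 - p k)) telescope_sumr// p0.
    by apply: le_lt_trans yx; rewrite lerD2r.
have stepn x n : (TV x (x + n%:R * (d / 2)) F <= n%:R%:E)%E.
  elim: n => [|n IH]; first by rewrite mul0r addr0 total_variationxx.
  have d20 : 0 <= d / 2 by rewrite divr_ge0// ltW.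
  have -> : (TV x (x + n.+1%:R * (d / 2)) F = TV x (x + n%:R * (d / 2)) F +
      TV (x + n%:R * (d / 2)) (x + n.+1%:R * (d / 2)) F)%E.
    apply: total_variationD; first by rewrite lerDl mulr_ge0.
    by rewrite lerD2l ler_wpM2r// ler_nat.
  have -> : (n.+1%:R%:E = n%:R%:E + 1%:E :> \bar R)%E by rewrite -EFinD natr1.
  apply: leeD => //; apply: step.
    by rewrite lerD2l ler_wpM2r// ler_nat.
  by rewrite -natr1 mulrDl mul1r; lra.
move=> x y xy; rewrite ge0_fin_numE; last exact: total_variation_ge0.
have [n ny] : exists n : nat, y <= x + n%:R * (d / 2).
  exists (Num.bound ((y - x) / (d / 2))).
  rewrite -lerBlDl -ler_pdivrMr ?divr_gt0//.
  by apply: ltW; apply: archi_boundP; rewrite divr_ge0 ?subr_ge0// ltW// divr_gt0.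
apply: (@le_lt_trans _ _ n%:R%:E); last by rewrite ltry.
apply: le_trans (stepn x n).
by rewrite (total_variationD F xy ny) leeDl// total_variation_ge0.
Qed.

Lemma total_variation_approx F x y (e : R) : ac_line F -> x <= y -> 0 < e ->
  exists p : nat -> R, exists m : nat, [/\ p 0%N = x,
    {homo p : i j / (i <= j)%N >-> i <= j}, forall k, p k <= y &
    forall M, (m <= M)%N -> fine (TV x y F) - e < \sum_(k < M) `|F (p k.+1) - F (p k)|].
Proof.
move=> Fac xy e0; have fin := ac_line_total_variation_fin Fac xy.
have [_ [_ [s xys <-] <-]] := ub_ereal_sup_adherent e0 fin.
have [p [p0 pm py pv]] := variation_sum_nodes F xys.
move=> h; exists p, (size s); split => // M sM; rewrite -pv//.
by rewrite -lte_fin EFinB fineK.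
Qed.

(** The maximum makes the function constant to the left of [a], hence monotone on the whole line. *)
Definition var_fun a F (x : R) : R := fine (TV a (Num.max a x) F).

Lemma var_funB a F x y : ac_line F -> x <= y ->
  var_fun a F y - var_fun a F x = fine (TV (Num.max a x) (Num.max a y) F).
Proof.
move=> Fac xy; have ax : a <= Num.max a x by rewrite le_max lexx.
have mxy : Num.max a x <= Num.max a y by rewrite ge_max le_max lexx/= le_max xy orbT.
rewrite /var_fun (total_variationD F ax mxy) fineD; first by rewrite addrC addKr.
- exact: ac_line_total_variation_fin.
- exact: ac_line_total_variation_fin.
Qed.

Lemma var_fun_ge a F x y : ac_line F -> x <= y ->
  `|F (Num.max a y) - F (Num.max a x)| <= var_fun a F y - var_fun a F x.
Proof.
move=> Fac xy; rewrite var_funB//.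
have mxy : Num.max a x <= Num.max a y by rewrite ge_max le_max lexx/= le_max xy orbT.
rewrite -lee_fin fineK; last exact: ac_line_total_variation_fin.
exact: total_variation_ge.
Qed.

(** Each interval is refined by a nearly optimal partition. The refined intervals still form one
    disjoint family of no greater total length, so absolute continuity of [F] bounds the sum over
    all of them. *)
Lemma ac_line_var_fun a F : ac_line F -> ac_line (var_fun a F).
Proof.
move=> Fac e e0; have [d d0 Fd] := Fac (e / 2) (divr_gt0 e0 (ltr0Sn _ _)).
exists d => // T I I12 tI Id.
pose x i := Num.max a (I i).1; pose y i := Num.max a (I i).2.
have xy i : x i <= y i by rewrite /x /y ge_max le_max lexx/= le_max I12 orbT.
(* The loss allowed per interval: the [#|T|] losses add up to at most [e / 2]. The successor covers
   an empty family. *)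
pose eta := e / 2 / #|T|.+1%:R.
have eta0 : 0 < eta by rewrite !divr_gt0.
have ch i := cid (total_variation_approx Fac (xy i) eta0).
pose p i := sval (ch i).
have ch' i := cid (svalP (ch i)).
pose m i := sval (ch' i).
have pm i : [/\ p i 0%N = x i, {homo p i : k j / (k <= j)%N >-> k <= j},
   forall k, p i k <= y i &
   forall M, (m i <= M)%N -> fine (TV (x i) (y i) F) - eta < \sum_(k < M) `|F (p i k.+1) - F (p i k)|].
  exact: (svalP (ch' i)).
pose M := (\max_i m i)%N.
have p_ge i k : x i <= p i k by have [<- h _ _] := pm i; exact: h.
have Fsum : \sum_i \sum_(k < M) `|F (p i k.+1) - F (p i k)| < e / 2.
  rewrite pair_big/=.
  apply: (Fd _ (fun ik : T * 'I_M => (p ik.1 ik.2, p ik.1 ik.2.+1))) => /=.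
  - by move=> [i k] /=; have [_ h _ _] := pm i; exact: h.
  - move=> [i k] [j l] _ _ [z /= []]; rewrite !in_itv/= => /andP[iz zi] /andP[jz zj].
    have Iz (i0 : T) (k0 : nat) : p i0 k0 < z -> z < p i0 k0.+1 -> (I i0).1 < z < (I i0).2.
      move=> h1 h2; have := le_lt_trans (p_ge i0 k0) h1.
      have [_ _ py _] := pm i0; have := lt_le_trans h2 (py k0.+1).
      rewrite /x /y gt_max => + /andP[az ->]; rewrite lt_max => /orP[|->//].
      by move=> /lt_trans/(_ az); rewrite ltxx.
    have ij : i = j.
      by apply: tI => //; exists z; split; rewrite /= in_itv/=; [exact: (Iz i k)|exact: (Iz j l)].
    rewrite -{j}ij in jz zj *; congr pair; apply: val_inj => /=.
    by have [_ h _ _] := pm i; exact: (nodes_trivIset h iz zi jz zj).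
  - rewrite -(pair_big xpredT xpredT (fun i (k : 'I_M) => p i k.+1 - p i k))/=.
    apply: le_lt_trans Id; apply: ler_sum => i _.
    rewrite -(big_mkord xpredT (fun k => p i k.+1 - p i k)) telescope_sumr//.
    have [-> _ py _] := pm i; apply: (@le_trans _ _ (y i - x i)); first by rewrite lerD2r.
    exact: max_contract.
have -> : \sum_i `|var_fun a F (I i).2 - var_fun a F (I i).1| = \sum_i fine (TV (x i) (y i) F).
  apply: eq_bigr => i _; rewrite var_funB// ger0_norm// fine_ge0//.
  by apply: total_variation_ge0; exact: xy.
apply: (@le_lt_trans _ _ (\sum_i (\sum_(k < M) `|F (p i k.+1) - F (p i k)| + eta))).
  apply: ler_sum => i _; have [_ _ _ /(_ M)] := pm i.
  by rewrite -lerBlDr => h; apply/ltW/h; exact: leq_bigmax.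
rewrite big_split/= sumr_const [e]splitr ltr_leD//.
apply: (@le_trans _ _ (eta * #|T|.+1%:R)); last by rewrite /eta divfK.
by rewrite -[eta *+ _]mulr_natr ler_wpM2l ?(ltW eta0)// ler_nat.
Qed.

(** * Lebesgue-Stieltjes measures and Radon-Nikodym densities *)

Local Notation mu := (@lebesgue_measure R).

Lemma open_interval_finite_measure (I : set R) : open I -> is_interval I ->
  (mu I < +oo)%E -> exists x y, x <= y /\ I = `]x, y[%classic.
Proof.
move=> oI iI Ioo; have mI : measurable I by exact: open_measurable.
have [->|/set0P[z Iz]] := eqVneq I set0.
  by exists 0, 0; split => //; rewrite set_itvoo0.
have lI : has_lbound I.
  apply: contrapT => /has_lbPn lI.
  have zI : `]-oo, z]%classic `<=` I.
    move=> r /=; rewrite in_itv/= => rz; have [y Iy yr] := lI r.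
    by apply: (iI y z) => //; rewrite (ltW yr).
  have : (mu `]-oo, z]%classic <= mu I)%E by apply: le_measure; rewrite ?inE.
  by move=> /le_lt_trans/(_ Ioo); rewrite lebesgue_measure_itv/= ltNyr/= ltxx.
have uI : has_ubound I.
  apply: contrapT => /has_ubPn uI.
  have zI : `[z, +oo[%classic `<=` I.
    move=> r /=; rewrite in_itv/= andbT => zr; have [y Iy ry] := uI r.
    by apply: (iI z y) => //; rewrite zr ltW.
  have : (mu `[z, +oo[%classic <= mu I)%E by apply: le_measure; rewrite ?inE.
  by move=> /le_lt_trans/(_ Ioo); rewrite lebesgue_measure_itv/= ltry/= ltxx.
have IE := interval_bounded_interior iI lI uI.
rewrite (interior_id _).1// in IE.
exists (inf I), (sup I); split.
  have /andP[h1 h2] : [set r | inf I < r < sup I] z by rewrite -IE.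
  exact: ltW (lt_trans h1 h2).
by rewrite {1}IE; apply/seteqP; split => x /=; rewrite in_itv.
Qed.

Lemma lebesgue_stieltjes_itvoc (f : cumulative R R) (x y : R) : x <= y ->
  lebesgue_stieltjes_measure f `]x, y]%classic = (f y - f x)%:E.
Proof.
move=> xy; rewrite /lebesgue_stieltjes_measure/= /measure_extension/=.
by rewrite measurable_mu_extE/= ?wlength_itv_bnd//; exact: is_ocitv.
Qed.

Section stieltjes.
Variable G : R -> R.
Hypotheses (ndG : nondecreasing G) (acG : ac_line G).

Let rcG : forall x, G @ at_right x --> G x.
Proof. by move=> x; apply: cvg_within_filter; exact: ac_line_continuous. Qed.

Let Gm := isCumulative.Build R _ R G ndG rcG.
Let Gc : cumulative R R := HB.pack G Gm.
Let nu := lebesgue_stieltjes_measure Gc.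

Let nu_itv x y : x <= y -> nu `]x, y]%classic = (G y - G x)%:E.
Proof. exact: (lebesgue_stieltjes_itvoc Gc). Qed.

(** Outer regularity encloses [A] in an open set of measure below the [d] that belongs to [e]. This
    open set is a disjoint union of intervals, and absolute continuity bounds the [nu]-mass of any
    finitely many of them by [e]. *)
Let nu_null (A : set (measurableTypeR R)) : measurable A -> mu A = 0%E -> nu A = 0%E.
Proof.
move=> mA A0; apply/eqP; rewrite eq_le measure_ge0 andbT.
apply/lee_addgt0Pr => e e0; rewrite add0e.
have [d d0 Gd] := acG e0.
have Aoo : (mu A < +oo)%E by rewrite A0.
have [U [oU AU Ud]] := lebesgue_regularity_outer mA Aoo d0.
have mU : measurable U by exact: open_measurable.
have Ud' : (mu U < d%:E)%E.
  apply: le_lt_trans Ud; rewrite -[leRHS]add0e -A0 -[in leLHS](setDUK AU).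
  by apply: measureU2 => //; exact: measurableD.
apply: (@le_trans _ _ (nu U)); first by apply: le_measure; rewrite ?inE.
pose I := open_disjoint_itv oU.
have mI k : measurable (I k) by apply: open_measurable; exact: open_disjoint_itv_open.
have IU k : I k `<=` U by rewrite [X in _ `<=` X](open_disjoint_itv_bigcup oU) => x Ix; exists k.
have tI : trivIset setT I by exact: open_disjoint_itv_trivIset.
have Ioo k : (mu (I k) < +oo)%E.
  apply: (@le_lt_trans _ _ (mu U)).
    by apply: le_measure; rewrite ?inE//; exact: mI.
  by rewrite (lt_trans Ud')// ltry.
have oI k : open (I k) by exact: open_disjoint_itv_open.
have iI k : is_interval (I k) by exact: open_disjoint_itv_is_interval.
have ch k := cid (open_interval_finite_measure (oI k) (iI k) (Ioo k)).
have ch' k := cid (svalP (ch k)).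
pose x k := sval (ch k); pose y k := sval (ch' k).
have xy k : x k <= y k by have [] := svalP (ch' k).
have IE k : I k = `]x k, y k[%classic by have [] := svalP (ch' k).
have UE : U = \bigcup_k I k by exact: open_disjoint_itv_bigcup.
have -> : nu U = (\sum_(k <oo) nu (I k))%E.
  have mUI : measurable (\bigcup_k I k : set (measurableTypeR R)) by rewrite -UE.
  have := measure_semi_bigcup (lebesgue_stieltjes_measure Gc) mI tI mUI.
  by rewrite -UE.
apply: lime_le; first by apply: is_cvg_nneseries => k _ _; exact: measure_ge0.
apply: nearW => n; rewrite big_mkord.
apply: (@le_trans _ _ (\sum_(k < n) (G (y k) - G (x k))%:E)%E).
  apply: lee_sum => k _; rewrite -nu_itv// -/(I k) IE.
  by apply: le_measure; rewrite ?inE//; exact: subset_itv_oo_oc.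
rewrite sumEFin lee_fin ltW//.
rewrite (eq_bigr (fun k : 'I_n => `|G (y k) - G (x k)|)); last first.
  by move=> k _; rewrite ger0_norm// subr_ge0 ndG.
apply: (Gd _ (fun k : 'I_n => (x k, y k))) => //=.
- move=> i j _ _ h; apply: val_inj => /=; apply: tI => //.
  by rewrite !IE.
- rewrite -lte_fin; apply: le_lt_trans Ud'; rewrite -sumEFin.
  rewrite (eq_bigr (fun k : 'I_n => mu (I k))); last first.
    move=> k _; rewrite IE lebesgue_measure_itv/= lte_fin.
    by case: ltP => // h; rewrite (@le_anti _ _ (x k) (y k)) ?h ?xy// subrr.
  rewrite -measure_bigsetU_ord//; last 2 first.
    by move=> i; exact: mI.
    by move=> i j _ _ h; apply: val_inj; apply: tI.
  apply: le_measure; rewrite ?inE//.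
    by apply: bigsetU_measurable => i _; exact: mI.
  by rewrite -(bigcup_mkord n I) => z [k _]; exact: IU.
Qed.

Lemma monotone_ac_density a c : a <= c -> exists2 h, mu.-integrable setT (EFin \o h) &
  forall x, a <= x <= c -> G x - G a = \int[mu]_(t in `]a, x]) h t.
Proof.
move=> ac; have mD : measurable (`]a, c]%classic : set (measurableTypeR R)) by exact: measurable_itv.
have nuD : (nu `]a, c]%classic < +oo)%E by rewrite nu_itv// ltry.
(* Radon-Nikodym is applied to a finite measure, hence the restriction to ]a, c]. *)
have dom : mfrestr mD nuD `<< mu.
  move=> N NN A mA AN; apply: nu_null; first exact: measurableI.
  apply: NN; first exact: measurableI.
  by move=> t [/AN].
have [h [h0 hfin Ih hE]] := radon_nikodym_sigma_finite dom.
have hfine : EFin \o (fine \o h) = h by apply/funext => t /=; rewrite fineK.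
exists (fine \o h); first by rewrite hfine.
move=> x /andP[ax xc].
have mx : measurable (`]a, x]%classic : set R) by exact: measurable_itv.
have := hE _ mx; rewrite /= /mfrestr /mrestr setIidl; last exact: subset_itvl.
rewrite (lebesgue_stieltjes_itvoc Gc ax) => e; rewrite /Rintegral.
under eq_integral do rewrite fineK//.
by rewrite -e.
Qed.

End stieltjes.

(** The Jordan decomposition [F = V - (V - F)], with [V] the variation function: both terms are
    nondecreasing and absolutely continuous, so each has a density. *)
Lemma ac_density a c F : a <= c -> absolutely_continuous_on a c F ->
  exists2 h, mu.-integrable setT (EFin \o h) &
    forall x, a <= x <= c -> F x - F a = \int[mu]_(t in `]a, x]) h t.
Proof.
move=> ac Fac; pose F' := F \o clamp a c.
have F'ac : ac_line F' by exact: ac_line_clamp.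
pose V := var_fun a F'.
have Vac : ac_line V by exact: ac_line_var_fun.
have F'max x : F' (Num.max a x) = F' x.
  by rewrite /F'/= /clamp; congr F; rewrite /Num.max /Num.min; do ![case: ifPn]; rewrite -?leNgt => *; lra.
have VF x y : x <= y -> `|F' y - F' x| <= V y - V x.
  by move=> xy; have := var_fun_ge a F'ac xy; rewrite !F'max.
have ndV : nondecreasing V.
  by move=> x y /VF h; rewrite -subr_ge0 (le_trans _ h).
have ndVF : nondecreasing (V \- F').
  by move=> x y /VF h /=; have := le_trans (ler_norm _) h; lra.
have [h1 I1 E1] := monotone_ac_density ndV Vac ac.
have [h2 I2 E2] := monotone_ac_density ndVF (ac_lineB Vac F'ac) ac.
exists (h1 \- h2); first by apply: intgB.
move=> x axc; have -> : F x - F a = (V x - V a) - ((V \- F') x - (V \- F') a).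
  have F'E t : a <= t <= c -> F' t = F t by move=> tac; rewrite /F'/= clamp_id.
  by rewrite /= !F'E ?lexx//; ring.
have mx : measurable (`]a, x]%classic : set R) by exact: measurable_itv.
rewrite E1// E2// -RintegralB//.
- exact: integrableS I1.
- exact: integrableS I2.
Qed.

(** Lebesgue differentiation identifies the density with [derive1 F]. The density supplies
    measurability and integrability, while [derive1 F] is what the hypotheses on [w] and [g]
    bound. *)
Lemma ac_FTC a c F : a <= c -> absolutely_continuous_on a c F ->
  exists h, [/\ mu.-integrable setT (EFin \o h),
    forall x, a <= x <= c -> F x - F a = \int[mu]_(t in `]a, x]) h t &
    {ae mu, forall t, a < t < c -> derivable F t 1 /\ derive1 F t = h t}].
Proof.
move=> ac Fac; have [h Ih hE] := ac_density ac Fac; exists h; split => //.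
have lh : locally_integrable setT h.
  by apply: open_integrable_locally => //; exact: openT.
have IhT y : mu.-integrable [set` Interval (BRight a) (BRight y)] (EFin \o h).
  exact: integrableS Ih.
have := FTC1 IhT lh; apply: aeS => t /= + /andP[at_ tc].
rewrite lte_fin => /(_ at_) [dt et].
pose H x := \int[mu]_(s in `]a, x]) h s.
have near_eq : \forall x \near t, (H \+ cst (F a)) x = F x.
  have : t \in `]a, c[ by rewrite in_itv/= at_.
  move=> /near_in_itvoo; apply: filterS => x; rewrite in_itv/= => /andP[ax xc].
  by rewrite /= /H -hE ?subrK// !ltW.
have dH' : derivable H t 1 by exact: dt.
have eH : derive1 H t = h t by exact: et.
rewrite derive1E in eH.
have dH : is_derive t 1 H (h t) := DeriveDef dH' eH.
have dF : is_derive t 1 F (h t + 0).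
  apply: (near_eq_is_derive near_eq); exact: (is_deriveD dH (is_derive_cst (F a) t 1)).
by rewrite addr0 in dF; split; [exact: ex_derive|rewrite derive1E; exact: derive_val].
Qed.

End absolutely_continuous_variation.

(** * Smooth bump functions *)

Section smooth_bump.
Context {R : realType}.
Implicit Types (f g : R -> R) (x : R) (r : {poly R}).

Lemma is_derive1_compose f g x df dg : is_derive x 1 g dg -> is_derive (g x) 1 f df ->
  is_derive x 1 (f \o g) (df * dg).
Proof.
move=> [dgx eg] [dfx ef].
have dg' : differentiable g x by exact/derivable1_diffP.
have df' : differentiable f (g x) by exact/derivable1_diffP.
have dfg' : differentiable (f \o g) x by exact: differentiable_comp.
have dfg : derivable (f \o g) x 1 by exact/derivable1_diffP.
apply: (DeriveDef dfg).
have H := derive1_comp dgx dfx.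
rewrite derive1E in H.
rewrite H.
rewrite 2!derive1E.
rewrite eg.
rewrite ef.
by [].
Qed.

Lemma near_eq_is_derive1 f g x d : (\forall y \near x, f y = g y) ->
  is_derive x 1 f d -> is_derive x 1 g d.
Proof. exact: near_eq_is_derive. Qed.

Definition smooth f : Prop := forall (n : nat) x, derivable (derive1n n f) x 1.

(** Smoothness by coinduction: it suffices to exhibit a class stable under differentiation, with no
    formula for the higher derivatives. *)
Lemma smooth_coind (S : set (R -> R)) :
  (forall f, S f -> exists2 g, S g & forall x, is_derive x 1 f (g x)) ->
  forall f, S f -> smooth f.
Proof.
move=> HS f Sf n; elim: n f Sf => [|n IH] f Sf x.
  by rewrite derive1n0; have [g _ /(_ x) []] := HS f Sf.
rewrite derive1Sn; have [g Sg fg] := HS f Sf.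
rewrite (_ : derive1 f = g); first exact: IH.
by apply/funext => y; rewrite derive1E; have [] := fg y.
Qed.

(* Cauchy's flat function exp (- 1 / x) at [j = 0]; the derivative of [flat j]
   is a combination of [flat j.+1] and [flat j.+2]. *)
Definition flat (j : nat) x : R := if 0 < x then x^-1 ^+ j * expR (- x^-1) else 0.

Lemma flat_ge0 j x : 0 <= flat j x.
Proof.
by rewrite /flat; case: ifPn => // x0; rewrite mulr_ge0 ?expR_ge0// exprn_ge0// invr_ge0 ltW.
Qed.

(** With [y = x^-1], this is the bound of the single term [y ^+ j / j!] by the exponential
    series. *)
Lemma flat_le_fact j x : flat j x <= j`!%:R.
Proof.
rewrite /flat; case: ifPn => // x0; have y0 : 0 <= x^-1 by rewrite invr_ge0 ltW.
rewrite expRN -ler_pdivlMr ?invr_gt0 ?expR_gt0// invrK.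
case: j => [|n]; first by rewrite expr0 fact0 mul1r -expR0 ler_expR.
have := expR_ge1Dxn n y0; rewrite -ler_pdivrMl ?ltr0n ?fact_gt0// mulrC.
by apply: le_trans; rewrite lerDr.
Qed.

Lemma flat_mul j x : flat j x = x * flat j.+1 x.
Proof.
rewrite /flat; case: ifPn => x0; last by rewrite mulr0.
by rewrite exprS !mulrA divff ?mul1r// gt_eqF.
Qed.

Lemma is_derive_flat j x : is_derive x 1 (flat j) (flat j.+2 x - j%:R * flat j.+1 x).
Proof.
have [x0|x0|x0] := ltgtP x 0.
- rewrite /flat !ifF ?(lt_gtF x0)// mulr0 subr0.
  apply: (near_eq_is_derive1 (f := cst 0)).
  near=> y; rewrite ifF//; apply/negbTE; rewrite -leNgt ltW//.
  by near: y; exact: lt_nbhsl.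
- have x1 : x != 0 by rewrite gt_eqF.
  apply: (near_eq_is_derive1 (f := (fun y => y^-1) ^+ j * (expR \o (- (fun y : R => y^-1))))).
    near=> y; have y0 : 0 < y by near: y; apply: lt_nbhsr.
    by rewrite /flat y0 /= !fctE.
  have dV : is_derive x 1 (fun y : R => y^-1) (- x ^- 2 *: 1) by exact: is_deriveV.
  have dE := is_derive1_compose (is_deriveN dV) (is_derive_expR _).
  apply: is_derive_eq (is_deriveM (is_deriveX j dV) dE) _.
  rewrite /flat x0 /= !fctE /GRing.scale/=.
  case: j => [|j]; first by rewrite !expr0 !mul0r; field.
  by rewrite !exprS /=; field.
- have F0 (k : nat) : flat k 0 = 0 by rewrite /flat ltxx.
  rewrite x0 !F0 mulr0 subr0.
  (* Two uses of [flat_mul] turn the quotient [flat j h / h] into [h * flat j.+2 h], which tends to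
     0 because [flat j.+2] is bounded. *)
  have c : h^-1 *: ((flat j \o shift 0) (h *: 1) - flat j 0) @[h --> 0^'] --> (0 : R).
    apply/cvgrPdist_lt => e e0; near=> h.
    rewrite sub0r normrN /= addr0 F0 subr0 /GRing.scale/= mulr1.
    have h0 : h != 0 by near: h; exact: nbhs_dnbhs_neq.
    rewrite flat_mul mulKf// flat_mul normrM (ger0_norm (flat_ge0 _ _)).
    apply: (@le_lt_trans _ _ (`|h| * (j.+2)`!%:R)).
      by rewrite ler_wpM2l// flat_le_fact.
    rewrite -ltr_pdivlMr ?ltr0n ?fact_gt0//.
    by near: h; apply: dnbhs0_lt; rewrite divr_gt0// ltr0n fact_gt0.
  apply: DeriveDef; first by apply/cvg_ex; exists 0.
  exact: cvg_lim c.
Unshelve. all: by end_near. Qed.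

(** The class of sums of [p(x) flat_j(r(x))] is stable under differentiation; a list of pairs
    [(p, j)] encodes such a sum. *)
Definition flatpoly r (s : seq ({poly R} * nat)) x : R :=
  \sum_(pj <- s) pj.1.[x] * flat pj.2 r.[x].

Definition flatpoly_deriv r (s : seq ({poly R} * nat)) : seq ({poly R} * nat) :=
  flatten [seq [:: (pj.1^`(), pj.2); (pj.1 * r^`(), pj.2.+2);
    (- (pj.2%:R *: (pj.1 * r^`())), pj.2.+1)] | pj <- s].

Lemma is_derive_flatpoly r s x :
  is_derive x 1 (flatpoly r s) (flatpoly r (flatpoly_deriv r s) x).
Proof.
elim: s => [|[p j] s IH].
  have -> : flatpoly r [::] = cst 0 by apply/funext => y; rewrite /flatpoly big_nil.
  exact: is_derive_cst.
pose G y := p.[y] * flat j r.[y].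
have dG : is_derive x 1 G (p^`().[x] * flat j r.[x] + (p * r^`()).[x] * flat j.+2 r.[x]
    + (- (j%:R *: (p * r^`()))).[x] * flat j.+1 r.[x]).
  have dF := is_derive1_compose (is_derive_poly r x) (is_derive_flat j r.[x]).
  apply: is_derive_eq (is_deriveM (is_derive_poly p x) dF) _.
  by rewrite !hornerE /GRing.scale/=; ring.
have -> : flatpoly r ((p, j) :: s) = G \+ flatpoly r s.
  by apply/funext => y; rewrite /flatpoly big_cons.
apply: is_derive_eq (is_deriveD dG IH) _.
by rewrite /flatpoly /flatpoly_deriv /= !big_cons/= !addrA.
Qed.

(** The product is positive exactly between [x1] and [x2], and the factor [n] makes the bumps tend
    pointwise to the indicator of ]x1, x2[. *)
Definition bump (n : nat) (x1 x2 : R) x : R := flat 0 (n%:R * ((x - x1) * (x2 - x))).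

Lemma bumpE n x1 x2 : bump n x1 x2 =
  flatpoly (n%:R%:P * (('X - x1%:P) * (x2%:P - 'X))) [:: (1, 0%N)].
Proof. by apply/funext => x; rewrite /flatpoly big_seq1/= /bump !hornerE. Qed.

Lemma bump_continuous n x1 x2 : continuous (bump n x1 x2).
Proof.
move=> x; apply: differentiable_continuous; apply/derivable1_diffP.
by rewrite bumpE; have [] := is_derive_flatpoly (n%:R%:P * (('X - x1%:P) * (x2%:P - 'X))) [:: (1, 0%N)] x.
Qed.

Lemma bump_ge0 n x1 x2 x : 0 <= bump n x1 x2 x.
Proof. exact: flat_ge0. Qed.

Lemma bump_le1 n x1 x2 x : bump n x1 x2 x <= 1.
Proof. exact: (flat_le_fact 0). Qed.

Lemma bump_out n x1 x2 x : x1 <= x2 -> ~~ (x1 < x < x2) -> bump n x1 x2 x = 0.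
Proof.
move=> x12 nx; rewrite /bump /flat ifF//; apply/negbTE; rewrite -leNgt.
apply: mulr_ge0_le0 => //; move: nx; rewrite negb_and -!leNgt => /orP[h|h].
  by apply: mulr_le0_ge0; lra.
by apply: mulr_ge0_le0; lra.
Qed.

Lemma bump_cvg1 x1 x2 x : x1 < x < x2 -> bump n x1 x2 x @[n --> \oo] --> (1 : R).
Proof.
move=> /andP[x1x xx2]; set c := (x - x1) * (x2 - x).
have c0 : 0 < c by apply: mulr_gt0; lra.
have : expR (- (c^-1 * n.+1%:R^-1)) @[n --> \oo] --> (1 : R).
  rewrite -[X in _ --> X]expR0; apply: continuous_cvg; first exact: continuous_expR.
  rewrite -[X in _ --> X]oppr0; apply: cvgN; rewrite -[X in _ --> X](mulr0 c^-1).
  by apply: cvgM; [exact: cvg_cst|exact: cvg_harmonic].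
move=> h; rewrite -(cvg_shiftS (fun n => bump n x1 x2 x)).
apply: cvg_trans h; apply: near_eq_cvg; apply: nearW => n.
have h0 : 0 < n.+1%:R * c by rewrite mulr_gt0.
rewrite /= /bump -/c /flat h0 expr0 mul1r; congr (expR (- _)).
by rewrite [RHS]invfM mulrC.
Qed.

Lemma smooth_bump_primitive (F : R -> R) n x1 x2 m y1 y2 (c : R) :
  (forall x, is_derive x 1 F (bump n x1 x2 x - c * bump m y1 y2 x)) -> smooth F.
Proof.
move=> dF.
pose r := n%:R%:P * (('X - x1%:P) * (x2%:P - 'X)) : {poly R}.
pose q := m%:R%:P * (('X - y1%:P) * (y2%:P - 'X)) : {poly R}.
pose S := [set f : R -> R | f = F \/ exists s t, f = flatpoly r s - c \*: flatpoly q t].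
apply: (@smooth_coind S); last by left.
move=> f [->|[s [t ->]]].
- exists (flatpoly r [:: (1, 0%N)] - c \*: flatpoly q [:: (1, 0%N)]).
    by right; exists [:: (1, 0%N)], [:: (1, 0%N)].
  by move=> x; have := dF x; rewrite !bumpE.
- exists (flatpoly r (flatpoly_deriv r s) - c \*: flatpoly q (flatpoly_deriv q t)).
    by right; exists (flatpoly_deriv r s), (flatpoly_deriv q t).
  move=> x; apply: is_deriveB; first exact: is_derive_flatpoly.
  by apply: is_deriveZ; exact: is_derive_flatpoly.
Qed.

End smooth_bump.

(** * The fundamental lemma of the calculus of variations *)

Section weak_derivatives.
Context {R : realType}.
Local Notation mu := (@lebesgue_measure R).
Local Notation intg f := (mu.-integrable setT (EFin \o f)).
Implicit Types (b : R) (f g D F : R -> R).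

Lemma intg_patch (A : set R) f : measurable A ->
  mu.-integrable A (EFin \o f) <-> intg (f \_ A).
Proof. by move=> mA; rewrite integrable_mkcond// restrict_EFin. Qed.

Lemma intgM_bounded f g (M : R) : intg f -> measurable_fun setT g ->
  (forall x, `|g x| <= M) -> intg (fun x => f x * g x).
Proof.
move=> If mg gM; apply: (intg_le (g := fun x => M * `|f x|)).
- by apply: measurable_funM => //; exact: intg_measurable.
- by move=> x; rewrite normrM mulrC ler_wpM2r.
- by apply: intgZ; exact: integrable_norm.
Qed.

Lemma intg_itv_indic (x y : R) : intg (\1_(`]x, y[%classic : set R)).
Proof. exact: (integrable_indic_itv x y false true). Qed.

Lemma measurable_bump n (x1 x2 : R) : measurable_fun setT (bump n x1 x2).
Proof. by apply: continuous_measurable_fun; exact: bump_continuous. Qed.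

Lemma bump_le_indic n (x1 x2 x : R) : x1 <= x2 ->
  `|bump n x1 x2 x| <= \1_(`]x1, x2[%classic : set R) x.
Proof.
move=> x12; rewrite ger0_norm ?bump_ge0// indicE.
have [|nx] := boolP (x1 < x < x2).
  by move=> h; rewrite mem_set ?bump_le1//= in_itv.
by rewrite bump_out// ler0n.
Qed.

Lemma intg_bump n (x1 x2 : R) : x1 <= x2 -> intg (bump n x1 x2).
Proof.
move=> x12; apply: (intg_le (g := \1_(`]x1, x2[%classic : set R))).
- exact: measurable_bump.
- by move=> x; exact: bump_le_indic.
- exact: intg_itv_indic.
Qed.

Lemma Rintegral_bump_cvg F (x1 x2 : R) : x1 <= x2 -> intg F ->
  \int[mu]_x (F x * bump n x1 x2 x) @[n --> \oo] --> \int[mu]_(x in `]x1, x2[) F x.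
Proof.
move=> x12 IF; have mF := intg_measurable IF.
rewrite Rintegral_mkcond; set G := F \_ _.
have mG : measurable_fun setT G.
  apply: (measurable_restrictT _ (measurable_itv `]x1, x2[)).1.
  exact: measurable_funTS.
pose f n x := (F x * bump n x1 x2 x)%:E.
have mf n : measurable_fun setT (f n).
  by apply/measurable_EFinP; apply: measurable_funM => //; exact: measurable_bump.
have cf : {ae mu, forall x, setT x -> f ^~ x @ \oo --> (EFin \o G) x}.
  apply: aeW => x _; apply: cvg_EFin; first exact: nearW.
  rewrite /f /G /= patchE; case: ifPn => [|nx].
    rewrite inE/= in_itv/= => /bump_cvg1 c; rewrite -[X in _ --> X]mulr1.
    by apply: cvgM => //; exact: cvg_cst.
  rewrite (_ : fine \o _ = cst 0); first exact: cvg_cst.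
  apply/funext => n /=; rewrite bump_out ?mulr0//.
  by apply: contraNN nx => h; rewrite inE/= in_itv.
have df : {ae mu, forall x n, setT x -> (`|f n x| <= `|F x|%:E)%E}.
  apply: aeW => x n _; rewrite /f /= lee_fin normrM -[leRHS]mulr1 ler_wpM2l//.
  by rewrite ger0_norm ?bump_ge0// bump_le1.
have mEG : measurable_fun setT (EFin \o G) by exact/measurable_EFinP.
have [IG _ c] := @dominated_convergence _ _ R mu setT measurableT f (EFin \o G)
  (fun x => `|F x|%:E) mf mEG cf (integrable_norm IF) df.
rewrite -EFin_Rintegral// in c.
exact: fine_cvg c.
Qed.

(** Subtracting the right multiple of a fixed reference bump gives any other bump mean zero, so [D]
    integrates against every bump as a constant [C] does. Letting bumps tend to indicators gives
    this on intervals, and Lebesgue differentiation gives it a.e. *)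
Lemma du_bois_reymond b D : 0 < b -> intg D ->
  (forall n m (x1 x2 y1 y2 c : R), 0 < x1 -> x1 < x2 -> x2 < b -> 0 < y1 -> y1 < y2 -> y2 < b ->
    \int[mu]_x (bump n x1 x2 x - c * bump m y1 y2 x) = 0 ->
    \int[mu]_x (D x * (bump n x1 x2 x - c * bump m y1 y2 x)) = 0) ->
  exists C : R, {ae mu, forall t, 0 < t < b -> D t = C}.
Proof.
move=> b0 ID H; have mD := intg_measurable ID.
pose y1 := b / 4; pose y2 := b / 2.
have y10 : 0 < y1 by rewrite /y1; lra.
have y12 : y1 < y2 by rewrite /y1 /y2; lra.
have y2b : y2 < b by rewrite /y2; lra.
(* The constant 1 is not integrable on the line; the indicator of ]0, b[ replaces it in
   [Rintegral_bump_cvg]. *)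
have bumpI n (x1 x2 : R) : 0 < x1 -> x1 < x2 -> x2 < b ->
    \int[mu]_x ((\1_(`]0, b[%classic : set R) x : R) * bump n x1 x2 x) = \int[mu]_x bump n x1 x2 x.
  move=> x10 x12 x2b; apply: eq_Rintegral => x _; rewrite indicE.
  have [/andP[h1 h2]|nx] := boolP (x1 < x < x2).
    by rewrite mem_set ?mul1r//= in_itv/=; apply/andP; split; lra.
  by rewrite bump_out ?mulr0// ltW.
have itvI (x1 x2 : R) : 0 < x1 -> x1 < x2 -> x2 < b ->
    \int[mu]_(x in `]x1, x2[) (\1_(`]0, b[%classic : set R) x : R) = x2 - x1.
  move=> x10 x12 x2b; rewrite (@eq_Rintegral _ _ _ mu _ (cst 1)).
    rewrite Rintegral_cst//= mul1r lebesgue_measure_itv/= lte_fin x12.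
    by rewrite -EFinB.
  move=> x; rewrite inE/= in_itv/= => /andP[h1 h2]; rewrite indicE mem_set//=.
  by rewrite in_itv/=; apply/andP; split; lra.
have [m beta0] : exists m, 0 < \int[mu]_x bump m y1 y2 x.
  have := Rintegral_bump_cvg (ltW y12) (intg_itv_indic 0 b).
  rewrite itvI// => /cvgr_gt /(_ 0) []; first by rewrite subr_gt0.
  by move=> N _ /(_ N (leqnn N)); rewrite /= bumpI//; exists N.
set beta := \int[mu]_x _ in beta0.
pose C := (\int[mu]_x (D x * bump m y1 y2 x)) / beta.
have Dbump n x1 x2 : x1 <= x2 -> intg (fun x => D x * bump n x1 x2 x).
  move=> x12; apply: (intgM_bounded (M := 1)) => //; first exact: measurable_bump.
  by move=> x; rewrite ger0_norm ?bump_ge0// bump_le1.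
have Hn n (x1 x2 : R) : 0 < x1 -> x1 < x2 -> x2 < b ->
    \int[mu]_x (D x * bump n x1 x2 x) = C * \int[mu]_x bump n x1 x2 x.
  move=> x10 x12 x2b; pose c := (\int[mu]_x bump n x1 x2 x) / beta.
  have := H n m x1 x2 y1 y2 c x10 x12 x2b y10 y12 y2b.
  rewrite RintegralB//; [|exact: intg_bump (ltW _)|by apply: intgZ; exact: intg_bump (ltW _)].
  rewrite RintegralZl//; last exact: intg_bump (ltW _).
  rewrite -/beta /c divfK ?gt_eqF// subrr => /(_ erefl).
  under eq_Rintegral do rewrite mulrBr mulrCA.
  rewrite RintegralB//; [|exact: Dbump (ltW _)|by apply: intgZ; exact: Dbump (ltW _)].
  rewrite RintegralZl//; last exact: Dbump (ltW _).
  by move=> /eqP; rewrite subr_eq0 => /eqP ->; rewrite /C; ring.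
have Hitv (x1 x2 : R) : 0 < x1 -> x1 < x2 -> x2 < b ->
    \int[mu]_(x in `]x1, x2[) D x = C * (x2 - x1).
  move=> x10 x12 x2b.
  have c1 := Rintegral_bump_cvg (ltW x12) ID.
  have c2 := Rintegral_bump_cvg (ltW x12) (intg_itv_indic 0 b).
  rewrite itvI// in c2.
  apply: (cvg_unique _ c1); first exact: norm_hausdorff.
  rewrite /= (_ : (fun n => _) =
      (fun n => C * \int[mu]_x ((\1_(`]0, b[%classic : set R) x : R) * bump n x1 x2 x))).
    exact: cvgM (cvg_cst C) c2.
  by apply/funext => n; rewrite Hn// bumpI.
exists C.
have lD : locally_integrable setT D by apply: open_integrable_locally => //; exact: openT.
have IDT a y : mu.-integrable [set` Interval (BRight a) (BRight y)] (EFin \o D).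
  exact: integrableS ID.
(* The interval identity is available only for left endpoints [x1 > 0], so ]0, b[ is exhausted from
   the right. *)
have step k : {ae mu, forall t, b / k.+2%:R < t < b -> D t = C}.
  pose a := b / k.+2%:R; have a0 : 0 < a by rewrite divr_gt0.
  have := FTC1 (IDT a) lD; apply: aeS => t /= + /andP[at_ tb].
  rewrite lte_fin => /(_ at_) [dt et].
  have : (fun y => \int[mu]_(x in `]a, y]) D x)^`()%classic t = C.
    rewrite derive1E.
    have dC : is_derive t 1 (fun y => C * (y - a)) C.
      have := is_deriveZ C (is_deriveB (is_derive_id t (1 : R)) (is_derive_cst a t (1 : R))).
      by rewrite subr0 [X in is_derive _ _ _ X]mulr1.
    suff [] : is_derive t 1 (fun y => \int[mu]_(x in `]a, y]) D x) C by [].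
    apply: (near_eq_is_derive1 _ dC).
    have : t \in `]a, b[ by rewrite in_itv/= at_.
    move=> /near_in_itvoo; apply: filterS => y; rewrite in_itv/= => /andP[ay yb].
    by rewrite -Hitv// Rintegral_itv_bndo_bndc//; exact: integrableS ID.
  by rewrite et.
have := ae_foralln step; apply: aeS => t Ht /andP[t0 tb].
have := archi_boundP (ltW (divr_gt0 b0 t0)); set N := Num.bound _ => bN.
apply: (Ht N); rewrite tb andbT ltr_pdivrMr// mulrC -ltr_pdivrMr//.
by apply: lt_le_trans bN _; rewrite ler_nat; exact: leqW (leqnSn N).
Qed.

(** Mean zero is what makes the primitive vanish again to the right of both bumps, hence have
    compact support in ]0, b[. *)
Lemma bump_primitive_test b n m (x1 x2 y1 y2 c : R) :
  0 < x1 -> x1 < x2 -> x2 < b -> 0 < y1 -> y1 < y2 -> y2 < b ->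
  let eta x := bump n x1 x2 x - c * bump m y1 y2 x in
  \int[mu]_x eta x = 0 ->
  let Phi x := \int[mu]_(t in `]-oo, x]) eta t in
  test_function b Phi /\ derive1 Phi = eta.
Proof.
move=> x10 x12 x2b y10 y12 y2b eta eta0 Phi.
have Ieta : intg eta.
  by apply: intgB; [exact: intg_bump (ltW _)|apply: intgZ; exact: intg_bump (ltW _)].
have IetaT y : mu.-integrable `]-oo, y] (EFin \o eta) by exact: integrableS Ieta.
have ceta : continuous eta.
  move=> x; apply: cvgB; first exact: bump_continuous.
  by apply: cvgM; [exact: cvg_cst|exact: bump_continuous].
have dPhi (x : R) : is_derive x 1 Phi (eta x).
  have xx1 : x < x + 1 by rewrite ltrDl.
  have [d e] := continuous_FTC1 xx1 (IetaT _) (ltNyr x) (ceta x).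
  have dP : derivable Phi x 1 by exact: d.
  have eP : derive1 Phi x = eta x by exact: e.
  rewrite derive1E in eP.
  exact: (DeriveDef dP eP).
pose p := Num.min x1 y1; pose q := Num.max x2 y2.
have p0 : 0 < p by rewrite lt_min x10.
have qb : q < b by rewrite gt_max x2b.
have etaE x : ~~ (p < x < q) -> eta x = 0.
  move=> npq; rewrite /eta bump_out ?(ltW x12)//; first rewrite bump_out ?(ltW y12) ?mulr0 ?subr0//.
  - by apply: contraNN npq => /andP[h1 h2]; rewrite gt_min lt_max h1 h2 !orbT.
  - by apply: contraNN npq => /andP[h1 h2]; rewrite gt_min lt_max h1 h2.
have PhiE x : Phi x != 0 -> `[p, q]%classic x.
  move=> Px; rewrite /= in_itv/=; apply: contraNT Px => npq; apply/eqP.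
  have [px|xp] := leP p x; last first.
    rewrite /Phi (@eq_Rintegral _ _ _ mu _ (cst 0)).
      by rewrite Rintegral_cst// mul0r.
    move=> t; rewrite inE/= in_itv/= => tx; apply: etaE.
    by rewrite negb_and -leNgt (le_trans tx (ltW xp)).
  have qx : q < x by rewrite px /= -ltNge in npq.
  rewrite -[RHS]eta0 /Phi Rintegral_mkcond; apply: eq_Rintegral => t _.
  rewrite patchE; case: ifPn => // ntx; apply/esym/etaE.
  rewrite negb_and -!leNgt; apply/orP; right.
  move: ntx; rewrite notin_setE/= in_itv/= => /negP; rewrite -ltNge => xt.
  by rewrite (le_trans (ltW qx) (ltW xt)).
have clo : closure [set x | Phi x != 0] `<=` `[p, q]%classic.
  have /closure_id -> : closed (`[p, q]%classic : set R) by exact: itv_closed.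
  exact: closureS.
split; last by apply/funext => x; rewrite derive1E; have [] := dPhi x.
split; first exact: smooth_bump_primitive dPhi.
- have cpq : compact (`[p, q]%classic : set R) by exact: segment_compact.
  have cc : closed (closure [set x | Phi x != 0]) by exact: closed_closure.
  refine (@subclosed_compact _ _ _ cc cpq clo).
- move=> x /clo; rewrite /= !in_itv/= => /andP[h1 h2].
  by rewrite (lt_le_trans p0 h1) (le_lt_trans h2 qb).
Qed.

Lemma weak_derivative_primitive b f g : 0 < b -> L1 b f -> L1 b g ->
  weak_derivative b f g ->
  exists C : R, {ae mu, forall t, 0 < t < b -> f t = C + \int[mu]_(s in `]0, t[) g s}.
Proof.
move=> b0 If Ig fg; pose I : set R := `]0, b[%classic.
have mI : measurable I by exact: measurable_itv.
pose ft := f \_ I; pose gt := g \_ I.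
have Ift : intg ft by apply: (intg_patch f mI).1.
have Igt : intg gt by apply: (intg_patch g mI).1.
have mgt := intg_measurable Igt.
(* [P t] is the tail integral of [g] from [t] on. Since [Phi] is a primitive from the left, Fubini
   gives that the integral of [g Phi] is that of [P eta], so [f + P] annihilates every mean-zero
   [eta]; [P] is the total integral minus the primitive sought. *)
pose W (p : R * R) : R := if p.2 <= p.1 then 1 else 0.
have mW : measurable_fun setT W.
  apply: measurable_fun_ifT => //.
  exact: measurable_fun_ler.
have W1 p : `|W p| <= 1 by rewrite /W; case: ifPn; rewrite ?normr1 ?normr0.
pose P t := \int[mu]_x (gt x * W (x, t)).
have mP : measurable_fun setT P.
  apply: (measurable_Rintegral_param (F := fun p : R * R => gt p.2 * W (p.2, p.1))).
  apply: measurable_funM; first exact: (measurableT_comp mgt measurable_snd).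
  by apply: (measurableT_comp mW); exact: measurable_fun_pair.
have IgW t : intg (fun x => gt x * W (x, t)).
  by apply: (intgM_bounded Igt (M := 1)) => //; exact: (measurable_fun_pair1 t mW).
have Pb t : `|P t| <= norm1 gt.
  apply: le_trans (le_normr_Rintegral measurableT (IgW t)) _.
  apply: le_Rintegral => //.
  - exact: (integrable_norm (IgW t)).
  - exact: (integrable_norm Igt).
  - by move=> x _; rewrite normrM -[leRHS]mulr1 ler_wpM2l.
pose D := ft \+ (fun t => (\1_I t : R) * P t).
have ID : intg D.
  by apply: intgD => //; apply: intgM_bounded Pb => //; exact: intg_itv_indic.
have [C HC] : exists C : R, {ae mu, forall t, 0 < t < b -> D t = C}.
  apply: du_bois_reymond => // n m x1 x2 y1 y2 c x10 x12 x2b y10 y12 y2b eta0.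
  have [tPhi dPhi] := bump_primitive_test x10 x12 x2b y10 y12 y2b eta0.
  have := fg _ tPhi; rewrite dPhi {dPhi}.
  move: eta0 tPhi; set eta := fun x => _ - _; set Phi := fun x => Rintegral _ _ _ => eta0 tPhi.
  have Ieta : intg eta.
    by apply: intgB; [exact: intg_bump (ltW _)|apply: intgZ; exact: intg_bump (ltW _)].
  have meta := intg_measurable Ieta.
  have etaM x : `|eta x| <= 1 + `|c|.
    rewrite /eta (le_trans (ler_normB _ _))// lerD//.
      by rewrite ger0_norm ?bump_ge0// bump_le1.
    rewrite normrM -[leRHS]mulr1 ler_wpM2l//.
    by rewrite ger0_norm ?bump_ge0// bump_le1.
  have etaI x : x \notin I -> eta x = 0.
    rewrite /I mem_setE in_itv/= => nx; rewrite /eta !bump_out ?mulr0 ?subr0 ?ltW//.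
    - by apply: contraNN nx => /andP[h1 h2]; apply/andP; split; lra.
    - by apply: contraNN nx => /andP[h1 h2]; apply/andP; split; lra.
  have -> : \int[mu]_(x in `]0, b[) (f x * eta x) = \int[mu]_x (ft x * eta x).
    rewrite Rintegral_mkcond; apply: eq_Rintegral => x _.
    by rewrite /ft !patchE; case: ifPn => //; rewrite mul0r.
  have -> : \int[mu]_(x in `]0, b[) (g x * Phi x) = \int[mu]_x (P x * eta x).
    transitivity (\int[mu]_x \int[mu]_t (gt x * W (x, t) * eta t)).
      rewrite Rintegral_mkcond; apply: eq_Rintegral => x _.
      have -> : (fun t => gt x * W (x, t) * eta t) = (fun t => gt x * ((eta \_ `]-oo, x]) t)).
        apply/funext => t; rewrite -mulrA; congr (_ * _); rewrite patchE /W/=.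
        rewrite mem_setE in_itv/=.
        by case: ifPn; rewrite ?mul1r ?mul0r.
      rewrite RintegralZl//; last first.
        by apply: (intg_patch _ (measurable_itv `]-oo, x])).1; exact: integrableS Ieta.
      rewrite -Rintegral_mkcond /gt !patchE; case: ifPn => //; by rewrite mul0r.
    rewrite (Rfubini (F := fun p => gt p.1 * W p * eta p.2)).
      by apply: eq_Rintegral => t _; rewrite /= RintegralZr.
    apply/integrable12ltyP.
      apply/measurable_EFinP; apply: measurable_funM; last exact: (measurableT_comp meta measurable_snd).
      apply: measurable_funM => //; exact: (measurableT_comp mgt measurable_fst).
    apply: (@le_lt_trans _ _ (\int[mu]_x (`|gt x| * norm1 eta)%:E)%E); last first.
      have Ign : intg (fun x => `|gt x| * norm1 eta).
        have := intgZ (norm1 eta) (integrable_norm Igt).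
        by apply: eq_integrable => // x _ /=; rewrite mulrC.
      by have := integrable_lty measurableT Ign; apply.
    have mF : measurable_fun setT (fun p : R * R => gt p.1 * W p * eta p.2).
      apply: measurable_funM; last exact: (measurableT_comp meta measurable_snd).
      by apply: measurable_funM => //; exact: (measurableT_comp mgt measurable_fst).
    apply: ge0_le_integral => //.
    - by move=> x _; exact: integral_ge0.
    - apply: (measurable_fun_fubini_tonelli_F (m2 := mu) (fun p => `|(gt p.1 * W p * eta p.2)%:E|)%E) => //.
      by apply: measurableT_comp => //; exact/measurable_EFinP.
    - by apply/measurable_EFinP; apply: measurable_funM => //; exact: measurableT_comp.
    move=> x _; rewrite EFinM norm1E// -ge0_integralZl//; last first.
      by apply/measurable_EFinP; exact: measurableT_comp.
    apply: ge0_le_integral => //.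
    - apply: measurableT_comp => //; apply/measurable_EFinP.
      exact: (measurable_fun_pair2 x mF).
    - apply: emeasurable_funM => //; apply/measurable_EFinP; exact: measurableT_comp.
    move=> t _ /=; rewrite -EFinM lee_fin !normrM ler_wpM2r// -[leRHS]mulr1 ler_wpM2l//.
  move=> e.
  have -> : (fun x => D x * eta x) = (fun x => ft x * eta x) \+ (fun x => P x * eta x).
    apply/funext => x; rewrite /D /= mulrDl; congr (_ + _).
    rewrite indicE; have [Ix|nIx] := boolP (x \in I); first by rewrite mul1r.
    by rewrite etaI ?mulr0.
  rewrite RintegralD//.
  - by rewrite e addNr.
  - exact: (intgM_bounded Ift meta etaM).
  - have := intgM_bounded Ieta mP Pb.
    by apply: eq_integrable => // x _ /=; rewrite mulrC.
exists (C - \int[mu]_x gt x); move: HC; apply: aeS => t Ht tb.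
have := Ht tb; rewrite /D /= indicE mem_set ?mul1r; last by rewrite /I/= in_itv.
rewrite /ft patchE mem_set; last by rewrite /I/= in_itv.
have -> : \int[mu]_(s in `]0, t[) g s = \int[mu]_x (gt x - gt x * W (x, t)).
  rewrite Rintegral_mkcond; apply: eq_Rintegral => x _.
  rewrite /gt /W /= !patchE !mem_setE !in_itv/=.
  have /andP[t0 t'b] := tb.
  case: (leP t x) => tx; rewrite ?mulr1 ?subrr ?mulr0 ?subr0 ?andbF// andbT.
  by rewrite (lt_trans tx t'b) andbT.
rewrite RintegralB// -/(P t) => <-; ring.
Qed.

End weak_derivatives.

(** * Jointly measurable derivatives *)

Section parametric_density.
Context {R : realType}.
Local Notation mu := (@lebesgue_measure R).
Local Notation intg f := (mu.-integrable setT (EFin \o f)).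
Implicit Types (b : R) (f a : R -> R).

(** Positive and negative parts are shifted separately, so the identity also covers integrands of
    [kercomp] at points where they may fail to be integrable. *)
Lemma Rintegral_shift f (c : R) : measurable_fun setT f ->
  \int[mu]_x f (x - c) = \int[mu]_x f x.
Proof.
move=> mf; have mE : measurable_fun setT (EFin \o f) by exact/measurable_EFinP.
have p := ge0_integral_shift c (measurable_funepos mE) (funepos_ge0 (EFin \o f)).
have n := ge0_integral_shift c (measurable_funeneg mE) (funeneg_ge0 (EFin \o f)).
rewrite /Rintegral; congr fine.
pose h (x : R) := (f (x - c))%:E.
have p' : (\int[mu]_x h^\+ x = \int[mu]_x (EFin \o f)^\+ x)%E.
  by rewrite -p; apply: eq_integral => x _; rewrite !funeposE.
have n' : (\int[mu]_x h^\- x = \int[mu]_x (EFin \o f)^\- x)%E.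
  by rewrite -n; apply: eq_integral => x _; rewrite !funenegE.
by rewrite integralE p' n' -integralE.
Qed.

Lemma measurable_le_set d (T : measurableType d) (f g : T -> R) :
  measurable_fun setT f -> measurable_fun setT g -> measurable [set p | f p <= g p].
Proof.
move=> mf mg; have mfg : measurable_fun setT (fun p => f p <= g p).
  exact: measurable_fun_ler.
rewrite (_ : [set p | _] = setT `&` (fun p => f p <= g p) @^-1` [set true]).
  exact: mfg.
by rewrite setTI.
Qed.

Lemma difference_quotient_cvg f (x : R) : derivable f x 1 ->
  n.+1%:R * (f (x + n.+1%:R^-1) - f x) @[n --> \oo] --> derive1 f x.
Proof.
move=> df; rewrite derive1E.
have /cvgr_dnbhsP/(_ (fun n : nat => n.+1%:R^-1)) /= H := df.
have un (n : nat) : (n.+1%:R^-1 : R) != 0 by rewrite invr_eq0 pnatr_eq0.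
have {}H := H (conj un (@cvg_harmonic R)).
apply: cvg_trans H; apply: near_eq_cvg; apply: nearW => n /=.
by rewrite invrK /GRing.scale/= mulr1 (addrC x).
Qed.

Lemma measurable_fun_inv : measurable_fun setT (fun x : R => x^-1).
Proof.
have -> : (fun x : R => x^-1) = (fun x => x * (x ^+ 2) `^ (-1)).
  apply/funext => x; have [->|x0] := eqVneq x 0; first by rewrite invr0 mul0r.
  by rewrite powR_inv1 ?sqr_ge0// expr2 invfM mulVKf.
apply: measurable_funM => //; apply: (measurableT_comp (measurable_powR (-1))).
exact: measurable_funX.
Qed.

(** Represents [g] through a Borel density bounded everywhere. As [h (s, x)] vanishes for [x <= 0],
    the indicator of [th - x] in ]0, b[ cuts the integral to 0 < x < th while keeping the form of a
    convolution with 1. *)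
Lemma measurable_ac_density b g a : 0 < b -> intg a -> (forall x, 0 <= a x) ->
  (forall x, x <= 0 -> a x = 0) ->
  lebesgue_measurable2 [set p | [/\ 0 <= p.1, 0 <= p.2 & p.1 + p.2 <= b]] g ->
  (forall s, 0 <= s <= b -> absolutely_continuous_on 0 (b - s) (g s)) ->
  (forall s, 0 <= s <= b ->
    {ae mu, forall t, 0 < t < b - s -> `|derive1 (g s) t| <= a t}) ->
  exists h : R * R -> R, exists gamma : R -> R,
    [/\ measurable_fun setT h, measurable_fun setT gamma,
      forall s x, `|h (s, x)| <= a x &
      {ae mu, forall s, 0 < s < b -> gamma s = g s 0 /\ forall th, 0 < th < b - s ->
        g s th = gamma s + \int[mu]_x ((\1_(`]0, b[%classic : set R) (th - x) : R) * h (s, x))}].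
Proof.
move=> b0 Ia a0 aneg [g' mg' /ae_prod_xsection gg'] acg dg.
set T := [set p : R * R | _] in mg' gg'.
have mT : measurable T.
  rewrite (_ : T = [set p : R * R | 0 <= p.1] `&` [set p : R * R | 0 <= p.2] `&`
    [set p : R * R | p.1 + p.2 <= b]).
    apply: measurableI; [apply: measurableI|]; apply: measurable_le_set => //.
    exact: measurable_funD.
  by apply/seteqP; split => p /=; [case|case=> -[]].
have ma := intg_measurable Ia.
pose G := g' \_ T.
have mG : measurable_fun setT G by apply: (measurable_restrictT _ mT).1.
(* [h] is a limit of difference quotients of the Borel version of [g], and [gamma]
   an average over [th]: both are measurable in [s], which [derive1 (g s)] and
   [g s 0] need not be. *)
pose q n (p : R * R) := n.+1%:R * (G (p.1, p.2 + n.+1%:R^-1) - G p).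
have mq n : measurable_fun setT (q n).
  apply: measurable_funM => //; apply: measurable_funB => //.
  apply: (measurableT_comp mG); apply: measurable_fun_pair => //.
  exact: measurable_funD.
pose hh p := fine (limn_esup (fun n => (q n p)%:E)).
have mhh : measurable_fun setT hh.
  apply: (measurableT_comp (@fine_measurable R setT measurableT)).
  apply: (@measurable_fun_limn_esup _ _ _ setT (fun n p => (q n p)%:E)) => n.
  exact/measurable_EFinP.
(* The cutoff enforces the bound everywhere; for a.e. [s] in ]0, b[ it is inactive at a.e. [x] in
   ]0, b - s[, where the limit is [derive1 (g s) x]. *)
pose h p := if `|hh p| <= a p.2 then hh p else 0.
have mh : measurable_fun setT h.
  apply: measurable_fun_ifT => //.
  apply: measurable_fun_ler; first exact: measurableT_comp.
  exact: (measurableT_comp ma).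
have hle s x : `|h (s, x)| <= a x.
  by rewrite /h /=; case: ifPn => // _; rewrite normr0.
pose U : R -> R := \1_(`]0, b[%classic : set R).
have mU : measurable_fun setT U by exact: measurable_indic.
pose P (p : R * R) := \int[mu]_x (U (p.2 - x) * h (p.1, x)).
have mP : measurable_fun setT P.
  apply: (measurable_Rintegral_param
    (F := fun p : (R * R) * R => U (p.1.2 - p.2) * h (p.1.1, p.2))).
  apply: measurable_funM.
    apply: (measurableT_comp mU); apply: measurable_funB => //.
    exact: (measurableT_comp measurable_snd measurable_fst).
  apply: (measurableT_comp mh); apply: measurable_fun_pair => //.
  exact: (measurableT_comp measurable_fst measurable_fst).
pose J (p : R * R) : R := if (0 < p.2) && (p.2 < b - p.1) then 1 else 0.
have mJ : measurable_fun setT J.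
  apply: measurable_fun_ifT => //; apply: measurable_and.
    exact: measurable_fun_ltr.
  by apply: measurable_fun_ltr => //; exact: measurable_funB.
pose gamma s := (b - s)^-1 * \int[mu]_x (J (s, x) * (G (s, x) - P (s, x))).
have mgamma : measurable_fun setT gamma.
  apply: measurable_funM.
    apply: (measurableT_comp measurable_fun_inv).
    exact: measurable_funB.
  apply: (measurable_Rintegral_param (F := fun p => J p * (G p - P p))).
  by apply: measurable_funM => //; exact: measurable_funB.
exists h, gamma; split => //.
move: gg'; apply: aeS => s gg' sb.
have [s0 s'b] := andP sb.
have sbW : 0 <= s <= b by rewrite !ltW.
have bs0 : 0 < b - s by rewrite subr_gt0.
have [hs [Ihs ghs dghs]] := ac_FTC (ltW bs0) (acg s sbW).
have GE : {ae mu, forall x, 0 < x < b - s -> G (s, x) = g s x}.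
  move: gg'; apply: aeS => x gx /andP[x0 xb].
  have sxb : s + x < b by rewrite addrC -ltrBrDr.
  have Tx : T (s, x) by split; exact: ltW.
  by rewrite /G patchE mem_set// -gx.
have GEn : {ae mu, forall x, forall n : nat, 0 < x + n.+1%:R^-1 < b - s ->
    G (s, x + n.+1%:R^-1) = g s (x + n.+1%:R^-1)}.
  apply: ae_foralln => n.
  by have := ae_shift (- n.+1%:R^-1) GE; apply: aeS => x; rewrite opprK.
have hE : {ae mu, forall x, 0 < x < b - s -> h (s, x) = hs x}.
  have := aeS2 (fun x p1 p2 => conj p1 p2) GE GEn => GE2.
  move: GE2 dghs (dg s sbW); apply: aeS3 => x [G1 G2] D1 D2 xb.
  have [dx ex] := D1 xb; rewrite -ex.
  have [x0 x'b] := andP xb.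
  have qc : (fun n => (q n (s, x))%:E) @ \oo --> (derive1 (g s) x)%:E.
    apply: cvg_EFin; first exact: nearW.
    apply: cvg_trans (difference_quotient_cvg dx).
    have h1 : (fun n : nat => x + n.+1%:R^-1) @ \oo --> x + 0.
      by apply: cvgD; [exact: cvg_cst|exact: cvg_harmonic].
    rewrite addr0 in h1.
    have [N _ HN] : \forall n \near \oo, x + n.+1%:R^-1 < b - s.
      exact: (cvgr_lt _ h1).
    apply: near_eq_cvg; exists N => // n /HN/= xn.
    by rewrite /q /= G1// G2// xn addr_gt0.
  have hhE : hh (s, x) = derive1 (g s) x.
    by rewrite /hh (cvg_limn_einf_sup qc).2.
  by rewrite /h hhE /= D2.
have PE th : 0 < th < b - s -> g s th = g s 0 + P (s, th).
  move=> /andP[th0 thb]; apply/eqP; rewrite addrC -subr_eq; apply/eqP.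
  rewrite ghs ?ltW//.
  rewrite -Rintegral_itv_bndo_bndc; last exact: integrableS Ihs.
  rewrite Rintegral_mkcond; apply: Rintegral_ae_eq.
  - apply: (measurable_restrictT _ (measurable_itv `]0, th[)).1.
    by apply: measurable_funTS; exact: intg_measurable Ihs.
  - apply: measurable_funM.
      by apply: (measurableT_comp mU); exact: measurable_funB.
    exact: (measurable_fun_pair2 s mh).
  move: hE; apply: aeS => x hx; rewrite patchE mem_setE in_itv/= /U indicE mem_setE in_itv/=.
  have [x0|x0] := ltP 0 x; last first.
    by have := hle s x; rewrite aneg// normr_le0 => /eqP ->; rewrite mulr0.
  have [xth|xth] := ltP x th; last by rewrite subr_gt0 ltNge xth mul0r.
  rewrite subr_gt0 xth/= (_ : th - x < b) ?mul1r; last by lra.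
  by rewrite hx// x0; lra.
suff ge : gamma s = g s 0 by split => // th /PE; rewrite ge.
rewrite /gamma (_ : \int[mu]_x _ = (b - s) * g s 0); first by rewrite mulKf// gt_eqF.
transitivity (\int[mu]_(x in `]0, b - s[) (g s 0)).
  rewrite [RHS]Rintegral_mkcond; apply: Rintegral_ae_eq.
  - by apply: (measurable_fun_pair2 s (f := fun p => J p * (G p - P p)));
    apply: measurable_funM => //; exact: measurable_funB.
  - by apply: (measurable_restrictT _ (measurable_itv `]0, b - s[)).1.
  move: GE; apply: aeS => x Gx; rewrite patchE mem_setE in_itv/= /J/=.
  case: ifPn => [xb|]; last by rewrite mul0r.
  by rewrite Gx// PE// mul1r addrK.
rewrite Rintegral_cst//= lebesgue_measure_itv/= lte_fin bs0 mulrC -EFinB/=.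
by rewrite subr0.
Qed.

End parametric_density.

(** * From the weighted to the classical Sonine condition *)

Section sonine_kernel.
Context {R : realType}.
Local Notation mu := (@lebesgue_measure R).
Local Notation intg f := (mu.-integrable setT (EFin \o f)).
Implicit Types (b : R) (f k K a : R -> R) (w g : R -> R -> R).

(* Extension by zero outside (0, b), so that convolutions become integrals over
   the whole line. *)
Definition zext b f : R -> R := f \_ (`]0, b[%classic : set R).

Lemma zextE b f x : zext b f x = if 0 < x < b then f x else 0.
Proof. by rewrite /zext patchE mem_setE in_itv. Qed.

Lemma zext_id b f x : 0 < x < b -> zext b f x = f x.
Proof. by rewrite zextE => ->. Qed.

Lemma zext_le0 b f x : x <= 0 -> zext b f x = 0.
Proof. by rewrite zextE leNgt => /negbTE ->. Qed.

Lemma intg_zext b f : L1 b f -> intg (zext b f).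
Proof. by move/(intg_patch f (measurable_itv `]0, b[)).1. Qed.

Definition shift_kernel f (p : R * R) : R := f (p.2 - p.1).

Lemma measurable_shift_kernel f : measurable_fun setT f ->
  measurable_fun setT (shift_kernel f).
Proof. by move=> mf; apply: (measurableT_comp mf); exact: measurable_funB. Qed.

Lemma shift_kernel_dominated f : measurable_fun setT f ->
  convolution_dominated (fun x => `|f x|) (shift_kernel f).
Proof. by move=> mf; split => //; exact: measurable_shift_kernel. Qed.

Lemma convE b f k t : 0 < t < b ->
  Defs.conv f k t = kerop (shift_kernel (zext b f)) (zext b k) t.
Proof.
move=> /andP[t0 tb]; rewrite /Defs.conv /kerop Rintegral_mkcond.
apply: eq_Rintegral => s _; rewrite /shift_kernel/= patchE mem_setE !zextE in_itv/= subr_gt0.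
have [s0|s0] := ltP 0 s; last by rewrite mulr0.
have [st|st] := ltP s t; last by rewrite mul0r.
by rewrite (lt_trans st tb) (_ : t - s < b)//; lra.
Qed.

Lemma kerop_shiftC f k : intg f -> intg k ->
  {ae mu, forall t, kerop (shift_kernel f) k t = kerop (shift_kernel k) f t}.
Proof.
move=> If Ik; have mf := intg_measurable If.
have Iaf : intg (fun x => `|f x|) by exact: integrable_norm.
have := kerop_ae_integrable Iaf (shift_kernel_dominated mf) Ik.
apply: aeS => t It; rewrite /kerop -(Rintegral_refl t It).
by apply: eq_Rintegral => s _; rewrite /shift_kernel/= subKr mulrC.
Qed.

Lemma integrable_shift (c : R) f : intg f -> intg (fun x => f (x - c)).
Proof.
move=> If; have := integrable_refl c (integrable_refl 0 If).
by apply: eq_integrable => // x _ /=; rewrite sub0r opprB.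
Qed.

(** The diagonal value is at most [M], and the integral of [w_2] is bounded by the norm of [wbar],
    uniformly in [s]. *)
Lemma weight_bounded b w : 0 < b -> admissible_weight b w ->
  exists2 M : R, 0 <= M & forall s t, 0 <= s -> s <= t -> t <= b -> `|w s t| <= M.
Proof.
move=> b0 [_ acw [m [M [m0 mM wM]]] [wbar Lw dw]].
pose v := zext b wbar; have Iv : intg v by exact: intg_zext.
exists (M + norm1 v); first by rewrite addr_ge0 ?norm1_ge0 ?(le_trans (ltW m0)).
move=> s t s0 st tb; have sb : s <= b by exact: le_trans st tb.
have s0b : 0 <= s <= b by rewrite s0.
have [h [Ih wh dwh]] := ac_FTC sb (acw s s0b).
have -> : w s t = w s s + (w s t - w s s) by rewrite addrC subrK.
apply: le_trans (ler_normD _ _) _; apply: lerD; first by have /andP[] := wM s s0b.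
rewrite wh ?st// -Rintegral_itv_bndo_bndc; last exact: integrableS Ih.
have Ivs := integrable_shift s (integrable_norm Iv).
have mh := intg_measurable Ih.
(* A version of the density that satisfies the a.e. bound at every point, as monotonicity of the
   integral asks. *)
pose Q x := if (s < x < t) && (`|h x| <= `|v (x - s)|) then h x else 0.
have mQ : measurable_fun setT Q.
  apply: measurable_fun_ifT => //; apply: measurable_and.
    by apply: measurable_and; exact: measurable_fun_ltr.
  apply: measurable_fun_ler; first exact: measurableT_comp.
  exact: (intg_measurable Ivs).
have Qle x : `|Q x| <= `|v (x - s)|.
  by rewrite /Q; case: ifPn => [/andP[]//|_]; rewrite normr0.
have IQ : intg Q by exact: intg_le Qle Ivs.
rewrite Rintegral_mkcond (@Rintegral_ae_eq _ _ Q)//.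
- apply: le_trans (le_normr_Rintegral measurableT IQ) _.
  rewrite /norm1 -(Rintegral_shift s (intg_measurable (integrable_norm Iv))).
  by apply: le_Rintegral => //; exact: integrable_norm.
- by apply: (measurable_restrictT _ (measurable_itv `]s, t[)).1; exact: measurable_funTS.
move: dwh (dw s s0b); apply: aeS2 => x hx wx; rewrite patchE mem_setE in_itv/= /Q.
have [/andP[sx xt]|//] := boolP (s < x < t).
have sxb : s < x < b by rewrite sx (lt_le_trans xt).
have := wx sxb; rewrite (hx sxb).2 => hw.
rewrite (_ : `|h x| <= _)//= /v zext_id; last by rewrite subr_gt0 sx/=; lra.
exact: le_trans hw (ler_norm _).
Qed.

(** [H (s, t)] is a Borel version of [w(s, t) k(t - s)] on 0 < s < t. Composing it with [K] and
    substituting [r = z + s] gives the left side of the Sonine condition at [(s, t - s)]. *)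
Lemma weighted_kernel b w k K g : 0 < b -> admissible_weight b w -> WSC1 b w k K g ->
  exists M : R, exists H : R * R -> R, [/\
    convolution_dominated (fun x => M * `|zext b k x|) H,
    forall s t, s <= 0 -> H (s, t) = 0,
    forall s t, t <= s -> H (s, t) = 0 &
    {ae mu, forall s, 0 < s < b -> {ae mu, forall t, s < t < b ->
      kercomp (shift_kernel (zext b K)) H (s, t) = g s (t - s)}}].
Proof.
move=> b0 Aw Wk; have [M M0 wM] := weight_bounded b0 Aw.
have [[w' mw' /ae_prod_xsection ww'] acw _ _] := Aw.
have Ik : intg (zext b k) by exact: intg_zext (WSC1_k Wk).
have IK : intg (zext b K) by exact: intg_zext (WSC1_K Wk).
have mk := intg_measurable Ik; have mK := intg_measurable IK.
set T := [set p : R * R | _] in mw' ww'.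
have mT : measurable T.
  rewrite (_ : T = [set p : R * R | 0 <= p.1] `&` [set p : R * R | p.1 <= p.2] `&`
    [set p : R * R | p.2 <= b]).
    by apply: measurableI; [apply: measurableI|]; apply: measurable_le_set.
  by apply/seteqP; split => p /=; [case|case=> -[]].
pose V := w' \_ T.
have mV : measurable_fun setT V by apply: (measurable_restrictT _ mT).1.
pose W (p : R * R) := if (0 < p.1) && (p.1 < p.2) && (`|V p| <= M) then V p else 0.
have mW : measurable_fun setT W.
  apply: measurable_fun_ifT => //; apply: measurable_and.
    by apply: measurable_and; exact: measurable_fun_ltr.
  by apply: measurable_fun_ler => //; exact: measurableT_comp.
have WM p : `|W p| <= M by rewrite /W; case: ifPn => [/andP[]//|_]; rewrite normr0.
exists M, (fun p => W p * shift_kernel (zext b k) p); split.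
- split; first by apply: measurable_funM => //; exact: measurable_shift_kernel.
  by move=> s t; rewrite normrM ler_wpM2r.
- by move=> s t s0; rewrite /W/= ltNge s0 mul0r.
- by move=> s t st; rewrite /W/= (ltNge s) st andbF mul0r.
move: ww'; apply: aeS => s ww' /andP[s0 sb].
have s0b : 0 <= s <= b by rewrite !ltW.
(* [w s] is controlled only on [s, b]; clamping gives a continuous function on the line with the
   same values there. *)
have mws : measurable_fun setT (w s \o clamp s b).
  apply: continuous_measurable_fun; apply: ac_line_continuous.
  by apply: ac_line_clamp (acw s s0b); exact: ltW.
have := ae_shift s (WSC1_eq Wk s0b); apply: aeS => t + /andP[st tb].
rewrite ltrBlDr subrK tb subr_gt0 st => /(_ isT) <-.
pose f z := zext b K (t - s - z) * (W (s, z + s) * zext b k z).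
transitivity (\int[mu]_r f (r - s)).
  apply: eq_Rintegral => r _; rewrite /f /shift_kernel /=.
  by rewrite subrK opprB addrA subrK.
have mf : measurable_fun setT f.
  apply: measurable_funM.
    by apply: (measurableT_comp mK); exact: measurable_funB.
  apply: measurable_funM => //.
  apply: (measurableT_comp (measurable_fun_pair2 s mW)); exact: measurable_funD.
rewrite Rintegral_shift// [RHS]Rintegral_mkcond.
pose q z := (w s \o clamp s b) (z + s) * zext b K (t - s - z) * zext b k z.
transitivity (\int[mu]_z (q \_ `]0, t - s[) z); last first.
  apply: eq_Rintegral => z _; rewrite !patchE; case: ifPn => //.
  rewrite mem_setE in_itv/= => /andP[z0 zt].
  by rewrite /q /= clamp_id ?zext_id//; lra.
apply: Rintegral_ae_eq => //.
  apply: (measurable_restrictT _ (measurable_itv `]0, t - s[)).1; apply: measurable_funTS.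
  apply: measurable_funM => //; apply: measurable_funM.
    by apply: (measurableT_comp mws); exact: measurable_funD.
  by apply: (measurableT_comp mK); exact: measurable_funB.
have := ae_shift (- s) ww'; apply: aeS => z; rewrite opprK patchE mem_setE in_itv/= => wz.
have [z0|z0] := ltP 0 z; last by rewrite /f (zext_le0 b k z0) !mulr0.
have [zt|zt] := ltP z (t - s); last first.
  by rewrite /f (zext_le0 b K) ?mul0r// subr_le0.
have Tz : T (s, z + s) by split => /=; lra.
rewrite /f /q /W /V /= patchE mem_set// -(wz Tz) s0 ltrDr z0/= wM; try lra.
by rewrite clamp_id; lra.
Qed.

Lemma WSC1_classical_sonine b w k K g : 0 < b -> admissible_weight b w ->
  WSC1 b w k K g -> exists kappa : R -> R, [/\ intg kappa,
    forall t, t <= 0 -> kappa t = 0 &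
    {ae mu, forall t, 0 < t < b -> kerop (shift_kernel (zext b K)) kappa t = 1}].
Proof.
move=> b0 Aw Wk.
have [M [H [domH H0 Hts compH]]] := weighted_kernel b0 Aw Wk.
have [M' M'0 wM'] := weight_bounded b0 Aw.
have bW : 0 <= b by exact: ltW.
have z0b : 0 <= (0 : R) <= b by rewrite lexx.
have Ik : intg (zext b k) by exact: intg_zext (WSC1_k Wk).
have IK : intg (zext b K) by exact: intg_zext (WSC1_K Wk).
have mk := intg_measurable Ik; have mK := intg_measurable IK.
have IaK : intg (fun x => `|zext b K x|) by exact: integrable_norm.
have IMk : intg (fun x => M * `|zext b k x|) by apply: intgZ; exact: integrable_norm.
have domK := shift_kernel_dominated mK.
have mH := convolution_dominated_measurable domH.
have [gbar Lg dg] := WSC1_deriv Wk.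
pose a x := `|zext b gbar x|; have Ia : intg a by apply: integrable_norm; exact: intg_zext.
have a0 x : 0 <= a x by exact: normr_ge0.
have aneg x : x <= 0 -> a x = 0 by move=> x0; rewrite /a zext_le0// normr0.
have dga s : 0 <= s <= b ->
    {ae mu, forall t, 0 < t < b - s -> `|derive1 (g s) t| <= a t}.
  move=> sb; move: (dg s sb); apply: aeS => t + /andP[t0 tb].
  rewrite t0 tb => /(_ isT) h; rewrite /a zext_id ?(le_trans h (ler_norm _))//.
  by rewrite t0/=; case/andP: sb => s0 _; lra.
have [h [gamma0 [mh mg0 hle hg]]] :=
  measurable_ac_density b0 Ia a0 aneg (WSC1_measurable Wk) (WSC1_ac Wk) dga.
have [m [N [m0 _ gmN]]] := WSC1_0 Wk.
(* Keeps the inverse bounded by [m^-1] everywhere; where [gamma0 s = g s 0], nothing changes. *)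
pose gamma s := if m <= `|gamma0 s| then gamma0 s else m.
have mgam : measurable_fun setT gamma.
  apply: measurable_fun_ifT => //; apply: measurable_fun_ler => //.
  exact: measurableT_comp.
have gam_m s : m <= `|gamma s|.
  by rewrite /gamma; case: ifPn => // _; rewrite gtr0_norm.
have gam0 s : gamma s != 0 by rewrite -normr_gt0 (lt_le_trans m0).
have gamV s : `|(gamma s)^-1| <= m^-1.
  by rewrite normfV lef_pV2 ?posrE// (lt_le_trans m0).
pose U : R -> R := \1_(`]0, b[%classic : set R).
have mU : measurable_fun setT U by exact: measurable_indic.
have U1 x : `|U x| <= 1 by rewrite /U indicE; case: (_ \in _); rewrite ?normr1 ?normr0.
have {}hg : {ae mu, forall s, 0 < s < b -> forall th, 0 < th < b - s ->
    g s th = gamma s + \int[mu]_x (U (th - x) * h (s, x))}.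
  move: hg; apply: aeS => s + sb => /(_ sb)[e Hs] th thb.
  rewrite Hs// /gamma e ifT//.
  by have /gmN/andP[] : 0 <= s <= b by case/andP: sb => ? ?; rewrite !ltW.
pose c := (g 0 0)^-1.
have g00 : g 0 0 != 0 by rewrite -normr_gt0; have /andP[/(lt_le_trans m0)] := gmN 0 z0b.
have ac0 : absolutely_continuous_on 0 b (g 0) by have := WSC1_ac Wk z0b; rewrite subr0.
(* The a.e. representation [hg] says nothing about the single value [s = 0], so [g 0] gets its own
   density; it forms the right side [psi]. *)
have [h0 Ih0 gh0] := ac_density bW ac0.
pose psi := zext b (fun x => - c * h0 x).
have Ipsi : intg psi.
  by apply: intg_zext; apply: integrableS (intgZ (- c) Ih0).
pose H2 (p : R * R) := if 0 < p.1 then h (p.1, p.2 - p.1) else 0.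
have domH2 : convolution_dominated a H2.
  split; last by move=> s t; rewrite /H2/=; case: ifPn => // _; rewrite normr0.
  apply: measurable_fun_ifT => //; first exact: measurable_fun_ltr.
  apply: (measurableT_comp mh); apply: measurable_fun_pair => //.
  exact: measurable_funB.
have mH2 := convolution_dominated_measurable domH2.
have mgV : measurable_fun setT (fun s => (gamma s)^-1).
  exact: (measurableT_comp measurable_fun_inv).
(* The unknown is changed to [chi = gamma phi], which brings the equation to the form with identity
   plus kernel. *)
pose H3 (p : R * R) := H2 p * (gamma p.1)^-1.
have domH3 : convolution_dominated (fun x => m^-1 * a x) H3.
  split; first by apply: measurable_funM => //; exact: (measurableT_comp mgV).
  move=> s t; rewrite /H3 normrM mulrC ler_pM//.
  exact: (convolution_dominated_le domH2).
have [chi [Ichi chi0 chiE]] : exists chi, [/\ intg chi,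
    forall t : R, ~~ (0 < t < b) -> chi t = 0 &
    {ae mu, forall t, 0 < t < b -> chi t + kerop H3 chi t = psi t}].
  apply: (@second_kind_volterra_solution _ b (fun x => m^-1 * a x)) => //.
  - exact: intgZ.
  - by move=> x x0; rewrite aneg ?mulr0.
  - by move=> s t s0; rewrite /H3 /H2 /= ltNge s0 mul0r.
  - by move=> t t0; rewrite /psi zext_le0.
pose phi s := chi s * (gamma s)^-1.
have Iphi : intg phi by exact: intgM_bounded mgV gamV.
have mphi := intg_measurable Iphi.
have gphi s : gamma s * phi s = chi s by rewrite /phi mulrCA mulfV ?mulr1.
pose W0 := w 0 \o clamp 0 b.
have mW0 : measurable_fun setT W0.
  apply: continuous_measurable_fun; apply: ac_line_continuous.
  exact: ac_line_clamp (weight_ac Aw z0b).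
have W0M x : `|W0 x| <= M'.
  by have /andP[h1 h2] := clamp_itv x bW; apply: wM'.
pose kap1 x := zext b k x * W0 x.
have Ikap1 : intg kap1 by exact: intgM_bounded mW0 W0M.
have Ikap2 : intg (kerop H phi) by exact: (kerop_integrable IMk domH).
exists (fun t => c * kap1 t + kerop H phi t); split.
- by apply: intgD => //; exact: intgZ.
- move=> t t0; rewrite /kap1 zext_le0// mul0r mulr0 add0r.
  rewrite /kerop (@eq_Rintegral _ _ _ mu _ (cst 0)); first by rewrite Rintegral_cst// mul0r.
  move=> s _ /=; have [ts|st] := leP t s; first by rewrite Hts// mul0r.
  by rewrite H0 ?mul0r//; exact: le_trans (ltW st) t0.
have EK1 : {ae mu, forall t, 0 < t < b ->
    kerop (shift_kernel (zext b K)) kap1 t = g 0 t}.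
  have := WSC1_eq Wk z0b; rewrite subr0; apply: aeS => t + tb.
  move=> /(_ tb) <-; rewrite [RHS]Rintegral_mkcond; apply: eq_Rintegral => z _.
  rewrite patchE mem_setE in_itv/= /shift_kernel/= /kap1 addr0.
  have [z0|z0] := ltP 0 z; last by rewrite (zext_le0 b k)// mul0r mulr0.
  have [zt|zt] := ltP z t; last by rewrite (zext_le0 b K) ?mul0r// subr_le0.
  case/andP: tb => t0 tb.
  rewrite /W0 /= clamp_id; last by lra.
  rewrite !zext_id; [ring|lra|lra].
(* [Q (s, t)] is the tail [g(s, t - s) - g(s, 0)], written as 1 convolved with [H2]. *)
pose Q p := kercomp (shift_kernel U) H2 p.
have mQ : measurable_fun setT Q.
  by apply: measurable_kercomp => //; exact: measurable_shift_kernel.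
have QE s t : 0 < s -> Q (s, t) = \int[mu]_x (U (t - s - x) * h (s, x)).
  move=> s0; pose f x := U (t - s - x) * h (s, x).
  have mf : measurable_fun setT f.
    apply: measurable_funM; last exact: (measurable_fun_pair2 s mh).
    by apply: (measurableT_comp mU); exact: measurable_funB.
  rewrite -[RHS](Rintegral_shift s mf); apply: eq_Rintegral => r _.
  by rewrite /shift_kernel /H2 /f /= s0 opprB addrA subrK.
have Qle s t : `|Q (s, t)| <= norm1 a.
  have mi : measurable_fun setT (fun r => shift_kernel U (r, t) * H2 (s, r)).
    apply: measurable_funM; last exact: (measurable_fun_pair2 s mH2).
    exact: (measurable_fun_pair1 t (measurable_shift_kernel mU)).
  have bi r : `|shift_kernel U (r, t) * H2 (s, r)| <= a (r - s).
    rewrite normrM -[leRHS]mul1r ler_pM//; first exact: U1.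
    exact: (convolution_dominated_le domH2).
  have Ias := integrable_shift s Ia.
  have Ii := intg_le mi bi Ias.
  apply: le_trans (le_normr_Rintegral measurableT Ii) _.
  rewrite /norm1 -(Rintegral_shift s (intg_measurable (integrable_norm Ia))).
  apply: le_Rintegral => //; [exact: integrable_norm|exact: integrable_norm|].
  by move=> r _; rewrite (le_trans (bi r))// ler_norm.
(* The indicator of the open triangle turns the conditional identity into an equality of Borel
   functions on the plane, as [ae_swap] requires. *)
pose J (p : R * R) : R := if (0 < p.1) && (p.1 < p.2) && (p.2 < b) then 1 else 0.
have mJ : measurable_fun setT J.
  apply: measurable_fun_ifT => //; apply: measurable_and.
    by apply: measurable_and; exact: measurable_fun_ltr.
  exact: measurable_fun_ltr.
pose KH := kercomp (shift_kernel (zext b K)) H.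
have mKH : measurable_fun setT KH.
  by apply: measurable_kercomp => //; exact: measurable_shift_kernel.
have swap : {ae mu, forall t, {ae mu, forall s,
    J (s, t) * KH (s, t) = J (s, t) * (shift_kernel U (s, t) * gamma s + Q (s, t))}}.
  apply: (@ae_swap R (fun p => J p * KH p)
     (fun p => J p * (shift_kernel U p * gamma p.1 + Q p))).
  - exact: measurable_funM.
  - apply: measurable_funM => //; apply: measurable_funD => //.
    apply: measurable_funM; first exact: measurable_shift_kernel.
    exact: (measurableT_comp mgam).
  move: compH hg; apply: aeS2 => s Hs gs.
  have [sb|nsb] := boolP (0 < s < b); last first.
    apply: aeW => t; rewrite /J/= ifF ?mul0r//.
    by apply/negbTE; apply: contraNN nsb => /andP[/andP[-> h1] h2]; exact: lt_trans h1 h2.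
  move: (Hs sb); apply: aeS => t Ht; rewrite /J /=.
  case: ifPn => [/andP[/andP[s0 st] tb]|]; last by rewrite !mul0r.
  rewrite !mul1r /KH Ht ?st// (gs sb); last by rewrite subr_gt0 st ltrD2r.
  rewrite QE// /shift_kernel/= (_ : U (t - s) = 1) ?mul1r//.
  by rewrite /U indicE mem_set//= in_itv/= subr_gt0 st; lra.
have IU2 : intg U by exact: intg_itv_indic.
have IaU : intg (fun x => `|U x|) by exact: integrable_norm.
have domU := shift_kernel_dominated mU.
have H3chi t : kerop H2 phi t = kerop H3 chi t.
  by apply: eq_Rintegral => s _; rewrite /H3 /phi /=; ring.
have IH2phi : intg (kerop H2 phi) by exact: (kerop_integrable Ia domH2).
have := keropD IaK domK (intgZ c Ikap1) Ikap2 => hD.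
have := keropZ IaK domK c Ikap1 => hZ.
have := kerop_comp IaK IMk domK domH Iphi => hC.
have := kerop_comp IaU Ia domU domH2 Iphi => hC2.
have := keropD IaU domU Ichi IH2phi => hD2.
have hA := aeS3 (fun x p1 p2 p3 => conj p1 (conj p2 p3)) hD hZ hC.
have hB := aeS3 (fun x p1 p2 p3 => conj p1 (conj p2 p3)) hC2 hD2 EK1.
move: hA hB swap; apply: aeS3 => t [-> [-> ->]] [e2 [e3 e1]] st tb.
have [t0 t'b] := andP tb.
rewrite e1// -/KH.
have UE x : U x = ((0 < x < b)%R : bool)%:R by rewrite /U indicE mem_setE in_itv.
have aneg' s x : x <= 0 -> h (s, x) = 0.
  by move=> x0; apply/eqP; rewrite -normr_le0 -(aneg x x0).
(* The right side is [- c (g(0, t) - g(0, 0))]; added to [c g(0, t)] it leaves [c g(0, 0) = 1]. *)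
have -> : kerop KH phi t = kerop (shift_kernel U) psi t; last first.
  have -> : kerop (shift_kernel U) psi t = - c * (g 0 t - g 0 0).
    rewrite gh0 ?ltW// -Rintegral_itv_bndo_bndc; last exact: integrableS Ih0.
    rewrite -RintegralZl//; last exact: integrableS Ih0.
    rewrite [RHS]Rintegral_mkcond; apply: eq_Rintegral => s _.
    rewrite /shift_kernel UE /psi zextE patchE mem_setE in_itv/= subr_gt0.
    have [s0|s0] := ltP 0 s; last by rewrite mulr0.
    have [st'|st'] := ltP s t; last by rewrite mul0r.
    rewrite (lt_trans st' t'b) (_ : t - s < b) ?mul1r//.
    by rewrite ltrBlDr (lt_trans t'b)// ltrDl.
  by rewrite mulNr -mulrBr subKr mulVf.
have mchi := intg_measurable Ichi.
have mUt : measurable_fun setT (fun s => shift_kernel U (s, t)).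
  exact: (measurable_fun_pair1 t (measurable_shift_kernel mU)).
have mQt : measurable_fun setT (fun s => Q (s, t)).
  exact: (measurable_fun_pair1 t mQ).
have KHle s : t <= s -> KH (s, t) = 0.
  move=> ts; rewrite /KH /kercomp (@eq_Rintegral _ _ _ mu _ (cst 0)).
    by rewrite Rintegral_cst// mul0r.
  move=> r _ /=; have [rs|sr] := leP r s; first by rewrite Hts// mulr0.
  by rewrite /shift_kernel/= zext_le0 ?mul0r// subr_le0 (le_trans ts (ltW sr)).
have Qt0 s : 0 < s -> t <= s -> Q (s, t) = 0.
  move=> s0 ts; rewrite QE// (@eq_Rintegral _ _ _ mu _ (cst 0)).
    by rewrite Rintegral_cst// mul0r.
  move=> x _ /=; have [x0|x0] := leP x 0; first by rewrite aneg' ?mulr0.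
  rewrite UE (_ : 0 < t - s - x = false) ?mul0r//; apply/negbTE; rewrite -leNgt.
  by rewrite subr_le0 (le_trans _ (ltW x0))// subr_le0.
(* The second-kind equation convolved with 1: [chi] contributes the jumps [gamma phi] and [H2 phi]
   the tails [Q phi]. *)
transitivity (kerop (shift_kernel U) (chi \+ kerop H2 phi) t); last first.
  apply: Rintegral_ae_eq.
  - apply: measurable_funM => //.
    exact: intg_measurable (intgD Ichi IH2phi).
  - by apply: measurable_funM => //; exact: intg_measurable Ipsi.
  move: chiE; apply: aeS => s es /=; rewrite H3chi.
  have [s0|s0] := ltP 0 s; last first.
    rewrite /psi zext_le0// chi0; last by rewrite ltNge s0.
    rewrite -H3chi /kerop (@eq_Rintegral _ _ _ mu _ (cst 0)).
      by rewrite Rintegral_cst// mul0r addr0.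
    move=> r _ /=; rewrite /H2/=; case: ifPn => [r0|]; last by rewrite mul0r.
    by rewrite aneg' ?mul0r// subr_le0 (le_trans s0 (ltW r0)).
  have [sb|sb] := ltP s b; first by rewrite es// s0.
  rewrite /shift_kernel UE/= subr_gt0 (_ : s < t = false) ?mul0r//.
  by apply/negbTE; rewrite -leNgt (le_trans (ltW t'b)).
rewrite e3 e2 /kerop -RintegralD//.
- apply: Rintegral_ae_eq.
  + by apply: measurable_funM => //; exact: (measurable_fun_pair1 t mKH).
  + apply: measurable_funD; apply: measurable_funM => //.
  move: st; apply: aeS => s es /=.
  have [sb|nsb] := boolP (0 < s < b); last first.
    by rewrite /phi (chi0 s nsb) mul0r !mulr0 addr0.
  have [s0 s'b] := andP sb.
  rewrite -(gphi s) mulrA -mulrDl; congr (_ * _).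
  have [ts|s't] := leP t s.
    rewrite KHle// -/(Q (s, t)) Qt0// /shift_kernel UE/= subr_gt0 (_ : s < t = false) ?mul0r ?add0r//.
    by rewrite ltNge ts.
  by move: es; rewrite /J/= s0 s't t'b/= !mul1r.
- have := intgM_bounded Ichi mUt (fun s => U1 _).
  by apply: eq_integrable => // s _ /=; rewrite mulrC.
- have := intgM_bounded Iphi mQt (fun s => Qle s t).
  by apply: eq_integrable => // s _ /=; rewrite mulrC.
Qed.

End sonine_kernel.

(** * Inversion of a Sonine kernel *)

Section sonine_inversion.
Context {R : realType}.
Local Notation mu := (@lebesgue_measure R).
Local Notation intg f := (mu.-integrable setT (EFin \o f)).
Implicit Types (b : R) (f k u phi : R -> R).

Lemma kerop_shift_le0 f u t : (forall x, x <= 0 -> f x = 0) ->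
  (forall x, x <= 0 -> u x = 0) -> t <= 0 -> kerop (shift_kernel f) u t = 0.
Proof.
move=> f0 u0 t0; rewrite /kerop (@eq_Rintegral _ _ _ mu _ (cst 0)).
  by rewrite Rintegral_cst// mul0r.
move=> s _ /=; have [s0|s0] := leP s 0; first by rewrite u0 ?mulr0.
by rewrite /shift_kernel/= f0 ?mul0r// subr_le0 (le_trans t0 (ltW s0)).
Qed.

Lemma kerop_shift_zext b f u t : (forall x, x <= 0 -> f x = 0) ->
  (forall x, x <= 0 -> u x = 0) -> t < b ->
  kerop (shift_kernel f) (zext b u) t = kerop (shift_kernel f) u t.
Proof.
move=> f0 u0 tb; apply: eq_Rintegral => s _ /=; rewrite zextE.
have [s0|s0] := ltP 0 s; last by rewrite u0.
have [//|bs] := ltP s b.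
by rewrite /shift_kernel/= f0 ?mul0r// subr_le0 (le_trans (ltW tb)).
Qed.

(** Associativity: the composed kernel at [(s, t)] is [(f * k)(t - s)], and reflection about [t]
    makes it 1 for a.e. [s] in ]0, t[. *)
Lemma sonine_inversion b f k phi : intg f -> intg k -> intg phi ->
  (forall x, x <= 0 -> f x = 0) -> (forall x, x <= 0 -> k x = 0) ->
  (forall x, x <= 0 -> phi x = 0) ->
  {ae mu, forall t, 0 < t < b -> kerop (shift_kernel f) k t = 1} ->
  {ae mu, forall t, 0 < t < b ->
    kerop (shift_kernel f) (kerop (shift_kernel k) phi) t = \int[mu]_(s in `]0, t[) phi s}.
Proof.
move=> If Ik Iphi f0 k0 phi0 fk1.
have mf := intg_measurable If; have mk := intg_measurable Ik.
have mphi := intg_measurable Iphi.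
have := kerop_comp (integrable_norm If) (integrable_norm Ik)
  (shift_kernel_dominated mf) (shift_kernel_dominated mk) Iphi.
apply: aeS => t -> /andP[t0 tb]; rewrite [RHS]Rintegral_mkcond.
have mfk : measurable_fun setT (kercomp (shift_kernel f) (shift_kernel k)).
  by apply: measurable_kercomp; exact: measurable_shift_kernel.
apply: Rintegral_ae_eq.
- by apply: measurable_funM => //; exact: (measurable_fun_pair1 t mfk).
- by apply: (measurable_restrictT _ (measurable_itv `]0, t[)).1; exact: measurable_funTS.
have compE s : kercomp (shift_kernel f) (shift_kernel k) (s, t) =
    kerop (shift_kernel f) k (t - s).
  pose q r := shift_kernel f (r, t - s) * k r.
  have mq : measurable_fun setT q.
    by apply: measurable_funM => //;
      exact: (measurable_fun_pair1 (t - s) (measurable_shift_kernel mf)).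
  rewrite /kerop -(Rintegral_shift s mq); apply: eq_Rintegral => r _.
  by rewrite /q /shift_kernel /= opprB addrA subrK.
have := ae_refl t fk1; apply: aeS => s; rewrite compE patchE mem_setE in_itv/=.
rewrite subr_gt0 => es.
have [s0|s0] := ltP 0 s; last by rewrite phi0 ?mulr0.
have [st|ts] := ltP s t; last by rewrite kerop_shift_le0 ?mul0r// subr_le0.
by rewrite es ?mul1r// st ltrBlDr (lt_trans tb)// ltrDl.
Qed.

(** The primitive is known to vanish only a.e. For a.e. [t] it vanishes at [t] and at all the points
    [t + n.+1%:R^-1] below [b], so its derivative, computed along this sequence, is 0; by Lebesgue
    differentiation that derivative is [phi t]. *)
Lemma primitive_eq0 b phi : intg phi ->
  {ae mu, forall t, 0 < t < b -> \int[mu]_(s in `]0, t[) phi s = 0} ->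
  {ae mu, forall t, 0 < t < b -> phi t = 0}.
Proof.
move=> Iphi H; pose F (y : R) := \int[mu]_(s in `]0, y]) phi s.
have IphiT y : mu.-integrable [set` Interval (BRight 0) (BRight y)] (EFin \o phi).
  exact: integrableS Iphi.
have lphi : locally_integrable setT phi.
  by apply: open_integrable_locally => //; exact: openT.
have HF : {ae mu, forall t, 0 < t < b -> F t = 0}.
  move: H; apply: aeS => t Ht tb.
  by rewrite /F -Rintegral_itv_bndo_bndc ?Ht//; exact: integrableS Iphi.
have HFn : {ae mu, forall t, forall n : nat, 0 < t + n.+1%:R^-1 < b ->
    F (t + n.+1%:R^-1) = 0}.
  apply: ae_foralln => n.
  by have := ae_shift (- n.+1%:R^-1) HF; apply: aeS => t; rewrite opprK.
move: (FTC1 IphiT lphi) HF HFn; apply: aeS3 => t /= + F0 Fn tb.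
have [t0 t'b] := andP tb; rewrite lte_fin => /(_ t0)[dF].
have dF' : derivable F t 1 by exact: dF.
suff F't0 : derive1 F t = 0 by move=> <-; exact: F't0.
have c0 : (fun n : nat => n.+1%:R * (F (t + n.+1%:R^-1) - F t)) @ \oo --> (0 : R).
  have h1 : (fun n : nat => t + n.+1%:R^-1) @ \oo --> t + 0.
    by apply: cvgD; [exact: cvg_cst|exact: cvg_harmonic].
  rewrite addr0 in h1.
  have [N _ HN] : \forall n \near \oo, t + n.+1%:R^-1 < b by exact: (cvgr_lt _ h1).
  apply: cvg_near_cst; exists N => // n /HN/= tn.
  by rewrite F0// Fn ?subrr ?mulr0// tn addr_gt0.
exact: (cvg_unique _ (difference_quotient_cvg dF') c0).
Qed.

End sonine_inversion.

(** * Solvability of the first-kind equation *)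

Unset Implicit Arguments.
Set Strict Implicit.
Set Printing Implicit Defensive.

Theorem theorem2p4 (R : realType) (b : R) (w : R -> R -> R) (k K : R -> R)
    (g : R -> R -> R) (hb : 0 < b) (hw : admissible_weight b w)
    (hk : WSC1 b w k K g) :
  (forall f : R -> R, W11 b f ->
     exists2 u : R -> R, volterra_solution b K f u &
       forall v : R -> R, volterra_solution b K f v ->
         {ae @lebesgue_measure R, forall t, 0 < t < b -> v t = u t}) /\
  (exists2 u : R -> R, volterra_solution b K (fun=> 1) u & CSC b K u).
Proof.
have [kappa [Ikap kap0 Kkap]] := WSC1_classical_sonine hb hw hk.
set mu := @lebesgue_measure R.
have LK := WSC1_K hk; have IK := intg_zext LK; have mK := intg_measurable IK.
have K0 x : x <= 0 -> zext b K x = 0 by exact: zext_le0.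
have IaK := integrable_norm IK; have domK := shift_kernel_dominated mK.
have mkap := intg_measurable Ikap.
have Iakap := integrable_norm Ikap; have domkap := shift_kernel_dominated mkap.
(* [CSC] and [volterra_solution] place the factors in opposite orders; uniqueness also uses [kappa]
   as a left inverse. *)
have kapK : {ae mu, forall t, 0 < t < b -> kerop (shift_kernel kappa) (zext b K) t = 1}.
  by move: (kerop_shiftC Ikap IK) Kkap; apply: aeS2 => t ->.
have Lintg (u : R -> R) : mu.-integrable setT (EFin \o u) -> L1 b u.
  by move=> Iu; exact: integrableS Iu.
have sol (u : R -> R) t : (forall x, x <= 0 -> u x = 0) -> 0 < t < b ->
    Defs.conv K u t = kerop (shift_kernel (zext b K)) u t.
  by move=> u0 tb; rewrite (convE _ _ tb) kerop_shift_zext//; case/andP: tb.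
split=> [f [Lf [g0 Lg fg]]|]; last first.
  have Lkap := Lintg _ Ikap.
  exists kappa; first by split => //; move: Kkap; apply: aeS => t + tb; rewrite sol// => ->.
  split => //; move: kapK; apply: aeS => t + tb => /(_ tb) <-.
  rewrite (convE _ _ tb); apply: eq_Rintegral => s _.
  have [s0|s0] := leP s 0; first by rewrite (K0 s)// !mulr0.
  rewrite /shift_kernel/= zextE; case: ifPn => // nts; rewrite kap0//.
  have [//|ts] := leP (t - s) 0; case/negP: nts; rewrite ts/=.
  by rewrite ltrBlDr (lt_trans (proj2 (andP tb)))// ltrDl.
have [C fC] := weak_derivative_primitive hb Lf Lg fg.
have Ig := intg_zext Lg.
have g00 x : x <= 0 -> zext b g0 x = 0 by exact: zext_le0.
pose u1 := kerop (shift_kernel kappa) (zext b g0).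
have Iu1 : mu.-integrable setT (EFin \o u1) by exact: (kerop_integrable Iakap domkap).
pose u t := C * kappa t + u1 t.
have Iu : mu.-integrable setT (EFin \o u) by apply: intgD => //; exact: intgZ.
have u0 x : x <= 0 -> u x = 0.
  by move=> x0; rewrite /u kap0// mulr0 add0r /u1 kerop_shift_le0.
have solu : volterra_solution b K f u.
  split; first exact: Lintg.
  have hD := keropD IaK domK (intgZ C Ikap) Iu1.
  have hZ := keropZ IaK domK C Ikap.
  have hI := sonine_inversion IK Ikap Ig K0 kap0 g00 Kkap.
  have hA := aeS3 (fun x p1 p2 p3 => conj p1 (conj p2 p3)) hD hZ hI.
  move: hA Kkap fC; apply: aeS3 => t [eD [eZ eI]] eK ef tb.
  rewrite sol// eD eZ eK// mulr1 eI// ef//; congr (_ + _).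
  apply: eq_Rintegral => s; rewrite inE/= in_itv/= => /andP[s0 st].
  by rewrite zext_id// s0 (lt_trans st)//; case/andP: tb.
exists u => // v [Lv solv].
have Iv := intg_zext Lv; have Izu := intg_zext solu.1.
pose d := zext b v \- zext b u.
have Id : mu.-integrable setT (EFin \o d) by exact: intgB.
have d0 x : x <= 0 -> d x = 0 by move=> x0; rewrite /d/= !zext_le0// subrr.
(* [e] vanishes only on (0, b), which suffices: by causality, [kappa * e] before time [b] sees no
   later values of [e]. *)
pose e := kerop (shift_kernel (zext b K)) d.
have eE : {ae mu, forall t, 0 < t < b -> e t = 0}.
  move: (keropB IaK domK Iv Izu) solv solu.2; apply: aeS3 => t eB ev eu tb.
  by rewrite /e eB -!(convE _ _ tb) ev// eu// subrr.
have e0 x : x <= 0 -> e x = 0 by move=> x0; rewrite /e kerop_shift_le0.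
have me : measurable_fun setT e.
  exact: intg_measurable (kerop_integrable IaK domK Id).
have : {ae mu, forall t, 0 < t < b -> d t = 0}.
  apply: primitive_eq0 => //.
  have := sonine_inversion Ikap IK Id kap0 K0 d0 kapK.
  apply: aeS => t + tb => /(_ tb) <-.
  rewrite -/e -(kerop_shift_zext kap0 e0 (proj2 (andP tb))).
  rewrite (eq_kerop (psi := cst 0)) //.
  - rewrite /kerop (@eq_Rintegral _ _ _ mu _ (cst 0)); last by move=> s _ /=; rewrite mulr0.
    by rewrite Rintegral_cst// mul0r.
  - exact: measurable_shift_kernel.
  - by apply: (measurable_restrictT _ (measurable_itv `]0, b[)).1; exact: measurable_funTS.
  by move: eE; apply: aeS => s es; rewrite zextE; case: ifPn => // /es.
apply: aeS => t + tb => /(_ tb); rewrite /d /= !zext_id// => /eqP.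
by rewrite subr_eq0 => /eqP.
Qed.
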